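(* Let $a>b>0$ and consider the ellipsoid $\mathbb E_{a,a,b,b}\subset\mathbb R^4$ defined by $$\frac{x^2+y^2}{a^2}+\frac{z^2+w^2}{b^2}=1,$$ oriented by the inner unit normal. Then: (i) The umbilic set is empty and the partially umbilic set is the union of the two circles $\mathcal P_{23}=\{(a\cos u,a\sin u,0,0)\}$ and $\mathcal P_{12}=\{(0,0,b\cos v,b\sin v)\}$. The curves $\mathcal P_{12}$ and $\mathcal P_{23}$ are linked in $\mathbb E_{a,a,b,b}$. (ii) The intermediate foliation $\mathcal F_2$ is singular on $\mathcal P_{12}\cup\mathcal P_{23}$, while $\mathcal F_1$ is singular only on $\mathcal P_{12}$ and $\mathcal F_3$ is singular only on $\mathcal P_{23}$. (iii) All regular leaves of $\mathcal F_1$ and $\mathcal F_3$ are circles, and the leaves of $\mathcal F_2$ are arcs of ellipses with boundary points located at $\mathcal P_{12}\cup\mathcal P_{23}$.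
   Context: For an ellipsoid in $\mathbb R^4$ with inner unit normal $N$, the principal curvatures $k_1\le k_2\le k_3$ at a point are the eigenvalues of $D(-N)$ on the tangent space. A point is umbilic if $k_1=k_2=k_3$. The partially umbilic set is the union of $\mathcal P_{12}$ (where $k_1=k_2<k_3$) and $\mathcal P_{23}$ (where $k_1<k_2=k_3$). The eigenline field of $k_i$ is denoted $\mathcal L_i$: $\mathcal L_1$ is defined off the umbilic set and $\mathcal P_{12}$, $\mathcal L_3$ off the umbilic set and $\mathcal P_{23}$, and $\mathcal L_2$ off the umbilic set, $\mathcal P_{12}$ and $\mathcal P_{23}$. $\mathcal F_i$ is the foliation by integral curves of $\mathcal L_i$; it is singular at the points where $\mathcal L_i$ is not defined. Two disjoint closed curves in the ellipsoid (a topological $3$-sphere) are linked if their linking number is nonzero. *)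

(* Defs.v *)
From mathcomp Require Import all_boot all_order all_algebra.
From mathcomp Require Import all_classical all_reals all_analysis.

Set Implicit Arguments.
Unset Strict Implicit.
Unset Printing Implicit Defensive.

Import Order.TTheory GRing.Theory Num.Theory.
Import numFieldNormedType.Exports.

Local Open Scope classical_set_scope.
Local Open Scope ring_scope.

Section Euclidean.
Context {R : realType}.

Definition dot n (u v : 'rV[R]_n) : R := (u *m v^T) 0 0.

(* The normed-module structure of 'rV[R]_n carries the sup norm; it only serves
   for limits and derivatives, and unit length refers to this norm. *)
Definition enorm n (u : 'rV[R]_n) : R := Num.sqrt (dot u u).

Definition grad (f : 'rV[R]_4 -> R) (p : 'rV[R]_4) : 'rV[R]_4 :=
  \row_i 'D_(delta_mx 0 i) f p.

Definition vec4 (x y z w : R) : 'rV[R]_4 := \row_i [:: x; y; z; w]`_i.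

Definition orthonormal2 n (e1 e2 : 'rV[R]_n) : Prop :=
  [/\ dot e1 e1 = 1, dot e2 e2 = 1 & dot e1 e2 = 0].

Definition ellipse_point n (c e1 e2 : 'rV[R]_n) (r1 r2 t : R) : 'rV[R]_n :=
  c + (r1 * cos t) *: e1 + (r2 * sin t) *: e2.

Definition is_circle n (A : set 'rV[R]_n) : Prop :=
  exists (c e1 e2 : 'rV[R]_n) (r : R),
    [/\ orthonormal2 e1 e2, 0 < r & A = range (ellipse_point c e1 e2 r r)].

(* [A] is an open arc of an ellipse, and its two boundary points lie in [B].
   The bound t0 + 2 pi makes these boundary points distinct. *)
Definition is_ellipse_arc_ending_in n (A B : set 'rV[R]_n) : Prop :=
  exists (c e1 e2 : 'rV[R]_n) (r1 r2 t0 t1 : R),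
    [/\ orthonormal2 e1 e2,
        0 < r1 /\ 0 < r2,
        t0 < t1 /\ t1 < t0 + pi *+ 2,
        A = ellipse_point c e1 e2 r1 r2 @` `]t0, t1[
      & B (ellipse_point c e1 e2 r1 r2 t0) /\
        B (ellipse_point c e1 e2 r1 r2 t1)].

End Euclidean.

(* A hypersurface [M] of R^4 oriented by a unit normal field [N]. [N] is given
   on the whole of R^4, but only its restriction to [M] matters below, as long
   as it is differentiable at the points of [M]: its differential is only
   applied to vectors tangent to [M]. *)
Section Hypersurface.
Context {R : realType}.
Variables (M : set 'rV[R]_4) (N : 'rV[R]_4 -> 'rV[R]_4).

(* A subspace of R^4 is encoded by a matrix whose row space it is; this one is
   the orthogonal complement of N p. *)
Definition tangent (p : 'rV[R]_4) : 'M[R]_4 := kermx (N p)^T.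

(* D(-N) at p, acting on row vectors: v |-> v *m shape p. *)
Definition shape (p : 'rV[R]_4) : 'M[R]_4 := jacobian (fun q => - N q) p.

(* The increasing list of the eigenvalues, with multiplicity, of the
   restriction of D(-N) to the tangent space. *)
Definition principal_curvatures (p : 'rV[R]_4) : seq R :=
  xget [::] [set s : seq R | sorted <=%R s /\
    char_poly (restrictmx (tangent p) (shape p)) = \prod_(x <- s) ('X - x%:P)].

(* k_i for i = 1, 2, 3. *)
Definition curvature (i : nat) (p : 'rV[R]_4) : R :=
  (principal_curvatures p)`_(i.-1).

Definition umbilic : set 'rV[R]_4 :=
  [set p | [/\ M p, curvature 1 p = curvature 2 p
             & curvature 2 p = curvature 3 p]].

Definition P12 : set 'rV[R]_4 :=
  [set p | [/\ M p, curvature 1 p = curvature 2 p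
             & curvature 2 p < curvature 3 p]].

Definition P23 : set 'rV[R]_4 :=
  [set p | [/\ M p, curvature 1 p < curvature 2 p
             & curvature 2 p = curvature 3 p]].

Definition partially_umbilic : set 'rV[R]_4 := P12 `|` P23.

Definition eigenline (i : nat) (p : 'rV[R]_4) : 'M[R]_4 :=
  (tangent p :&: eigenspace (shape p) (curvature i p))%MS.

(* The set of points where the i-th eigenline field is not defined
   (i = 1, 2, 3). *)
Definition foliation_sing (i : nat) : set 'rV[R]_4 :=
  match i with
  | 1%N => umbilic `|` P12
  | 3%N => umbilic `|` P23
  | _ => umbilic `|` (P12 `|` P23)
  end.

Definition integral_curve (i : nat) (s t : R) (c : R -> 'rV[R]_4) : Prop :=
  forall u, u \in `]s, t[ ->
    [/\ M (c u) /\ ~ foliation_sing i (c u),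
        derivable c u 1,
        {for u, continuous (derive1 c)},
        derive1 c u != 0
      & (derive1 c u <= eigenline i (c u))%MS].

(* The leaf through p, i.e. the trace of the maximal integral curve through p:
   the union of the traces of all the integral curves through p. *)
Definition leaf (i : nat) (p : 'rV[R]_4) : set 'rV[R]_4 :=
  [set q | exists (s t : R) (c : R -> 'rV[R]_4),
     [/\ integral_curve i s t c, (c @` `]s, t[) p & (c @` `]s, t[) q]].

Definition simple_closed_curve (g : R -> 'rV[R]_4) (A : set 'rV[R]_4) : Prop :=
  [/\ forall t, derivable g t 1 /\ derive1 g t != 0,
      continuous (derive1 g),
      forall t, g (t + pi *+ 2) = g t,
      {in `[0, pi *+ 2[ &, injective g}
    & A = range g].

Definition disc : set 'rV[R]_2 := [set q | q 0 0 ^+ 2 + q 0 1 ^+ 2 <= 1].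
Definition open_disc : set 'rV[R]_2 := [set q | q 0 0 ^+ 2 + q 0 1 ^+ 2 < 1].

(* [f] is a (singular) disc in M bounded by the closed curve g, of class C^1 in
   its interior. *)
Definition spanning_disc (g : R -> 'rV[R]_4) (f : 'rV[R]_2 -> 'rV[R]_4) : Prop :=
  [/\ forall q, disc q -> M (f q),
      {within disc, continuous f},
      forall q, open_disc q ->
        differentiable f q /\ {for q, continuous (jacobian f)}
    & forall u, f (\row_i [:: cos u; sin u]`_i) = g u].

Definition crossings (f : 'rV[R]_2 -> 'rV[R]_4) (g : R -> 'rV[R]_4) :
    set ('rV[R]_2 * R) :=
  [set x | [/\ disc x.1, x.2 \in `[0, pi *+ 2[ & f x.1 = g x.2]].

(* The rows of this matrix are the two partial derivatives of f, the velocity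
   of g and the normal; as the first three are tangent to M, the determinant
   vanishes iff the crossing is not transverse in M, and otherwise its sign is
   that of the crossing for the orientation of M defined by N. *)
Definition crossing_det (f : 'rV[R]_2 -> 'rV[R]_4) (g : R -> 'rV[R]_4)
    (x : 'rV[R]_2 * R) : R :=
  \det (col_mx (jacobian f x.1) (col_mx (derive1 g x.2) (N (f x.1))) : 'M[R]_4).

(* The linking number of two disjoint closed curves of a 3-sphere M is the
   algebraic intersection number of the second one with a surface bounded by
   the first one. Since M is simply connected the surface can be taken to be a
   (singular) disc, in general position with respect to the second curve; since
   H_2(M) = 0 the result does not depend on the disc. *)
Definition has_linking_number (g1 g2 : R -> 'rV[R]_4) (n : int) : Prop :=
  exists f : 'rV[R]_2 -> 'rV[R]_4,
    [/\ spanning_disc g1 f,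
        finite_set (crossings f g2),
        forall x, crossings f g2 x -> crossing_det f g2 x != 0
      & n = \sum_(x \in crossings f g2) sgz (crossing_det f g2 x)].

(* Changing the parametrizations only affects the sign of the linking number. *)
Definition linked (A B : set 'rV[R]_4) : Prop :=
  [/\ A `<=` M, B `<=` M, A `&` B = set0
    & exists (g1 g2 : R -> 'rV[R]_4) (n : int),
        [/\ simple_closed_curve g1 A, simple_closed_curve g2 B,
            has_linking_number g1 g2 n & n != 0]].

End Hypersurface.

Section Ellipsoid.
Context {R : realType}.
Variables a b : R.

Definition quadric (p : 'rV[R]_4) : R :=
  (p 0 0 ^+ 2 + p 0 1 ^+ 2) / a ^+ 2 + (p 0 2 ^+ 2 + p 0 3 ^+ 2) / b ^+ 2.

Definition ellipsoid : set 'rV[R]_4 := [set p | quadric p = 1].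

(* The gradient of [quadric] points outwards. *)
Definition inner_normal (p : 'rV[R]_4) : 'rV[R]_4 :=
  - ((enorm (grad quadric p))^-1 *: grad quadric p).

End Ellipsoid.

(* Main.v *)
Require Import Defs.
From mathcomp Require Import all_boot all_order all_algebra.
From mathcomp Require Import all_classical all_reals all_analysis.
From mathcomp Require Import ring lra.
Import Order.TTheory GRing.Theory Num.Theory.
Import numFieldNormedType.Exports.
Local Open Scope classical_set_scope.
Local Open Scope ring_scope.
Set Implicit Arguments.
Unset Strict Implicit.

(** The ellipsoid is invariant under the rotations of the (x, y)-plane and of
    the (z, w)-plane, so each of its points has the form
      p = (a C e(u), b S e(v)),  e(t) = (cos t, sin t),  C, S >= 0,
      C^2 + S^2 = 1.
    At p the three mutually orthogonal vectors
      (e'(u), 0),  (- a S e(u), b C e(v)),  (0, e'(v))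
    span the tangent space.  The first and the third are tangent to the orbits
    of the two rotations, the second one to the meridian ellipse
    t |-> (a cos t e(u), b sin t e(v)).  With h the norm of the gradient of the
    quadratic form, -N is the gradient divided by h, and a direct computation
    ([frame_shape]) shows that these vectors are eigenvectors of D(-N), with
    eigenvalues
      2 / (a^2 h),  8 / (a^2 b^2 h^3),  2 / (b^2 h).
    Since h^2 = 4 (C^2 / a^2 + S^2 / b^2), the two successive gaps are positive
    multiples of C^2 and S^2 ([curvatures_gap]).  So this order is the
    increasing one, k_1 = k_2 exactly when C = 0, that is on the circle of the
    (z, w)-plane, and k_2 = k_3 exactly when S = 0, that is on the circle of
    the (x, y)-plane.  This gives the partially umbilic set and the singular
    sets, and it identifies each eigenline off its singular set
    ([eigenline_torus]).

    The leaves are found from first integrals, without solving any differential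
    equation.  Along a curve tangent to the first eigenline field (z, w) and
    x^2 + y^2 are constant, hence the leaf lies on a circle; the third field is
    symmetric.  Along a curve tangent to the second one the velocity in each of
    the two planes is parallel to the position, so the directions e(u) and e(v)
    do not change and the leaf lies on the open quarter of the meridian ellipse
    between the two singular circles.  Conversely the circle or the quarter
    ellipse, parametrized by its angle, is an integral curve.

    For the linking number, the graph
      (r, s) |-> (a sqrt (1 - r^2 - s^2), 0, b r, b s)
    is a disc in the ellipsoid bounded by the circle of the (z, w)-plane.  It
    meets the circle of the (x, y)-plane only at its centre, transversally, so
    the linking number is 1 or -1. *)

(** * Eigenvalues of the restriction to an invariant subspace *)

Lemma char_poly_conj_unit (F : fieldType) (n : nat) (P A : 'M[F]_n) :
  P \in unitmx -> char_poly (P *m A *m invmx P) = char_poly A.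
Proof.
move=> Pu; pose Q := map_mx polyC P; pose Q' := map_mx polyC (invmx P).
have QQ' : Q *m Q' = 1%:M by rewrite -map_mxM mulmxV ?map_mx1.
have -> : char_poly (P *m A *m invmx P) = \det (Q *m char_poly_mx A *m Q').
  congr determinant; rewrite /char_poly_mx mulmxBr mulmxBl !map_mxM.
  by rewrite scalar_mxC -[_%:M *m Q *m Q']mulmxA QQ' mulmx1.
by rewrite !det_mulmx mulrAC -det_mulmx QQ' det1 mul1r.
Qed.

(** [B] is another basis of [V]; it differs from the basis chosen by [row_base]
    by an invertible matrix, and conjugation preserves the characteristic
    polynomial. *)
Lemma char_poly_restrictmx (F : fieldType) (m n : nat)
    (B : 'M[F]_(m, n)) (V f : 'M[F]_n) (d : 'rV[F]_m) :
    row_free B -> (B :=: V)%MS -> B *m f = diag_mx d *m B ->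
  char_poly (restrictmx V f) = \prod_i ('X - (d 0 i)%:P).
Proof.
move=> freeB eqBV eigB.
suff conjW k (W : 'M[F]_(k, n)) : k = m -> row_free W -> (W :=: B)%MS ->
    char_poly (conjmx W f) = \prod_i ('X - (d 0 i)%:P).
  apply: conjW; [by rewrite -eqBV; apply/eqP | exact: row_base_free|].
  by apply: eqmx_trans (eq_row_base V) (eqmx_sym eqBV).
move=> km; subst k => freeW eqWB.
pose P := W *m pinvmx B.
have WPB : W = P *m B by rewrite mulmxKpV ?eqWB.
have Pu : P \in unitmx.
  by rewrite -row_free_unit /row_free -(mxrankMfree _ freeB) -WPB.
have Bconj : conjmx B f = diag_mx d by rewrite /conjmx eigB mulmxKp.
have Bstab : stablemx B f by rewrite eigB submxMl.
rewrite WPB conjuMmx // Bconj /conjmx pinvmxE // char_poly_conj_unit //.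
rewrite char_poly_trig ?diag_mx_is_trig //.
by apply: eq_bigr => i _; rewrite mxE eqxx mulr1n.
Qed.

(** This makes the list of principal curvatures well defined. *)
Lemma sorted_roots_unique (R : realFieldType) (s t : seq R) :
    sorted <=%R s -> sorted <=%R t ->
  \prod_(x <- s) ('X - x%:P) = \prod_(x <- t) ('X - x%:P) -> s = t.
Proof.
move=> ss st eqst; have peq : perm_eq s t by apply: prod_XsubC_eq.
exact: (sorted_eq le_trans le_anti) peq.
Qed.

(** In the basis [B] the map is diagonal, so the coordinates of an eigenvector
    for [d 0 i] vanish at each [j] where [d 0 j] differs from [d 0 i]. *)
Lemma eigenline_simple (F : fieldType) (m n : nat)
    (B : 'M[F]_(m, n)) (V f : 'M[F]_n) (d : 'rV[F]_m) (i : 'I_m) :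
    row_free B -> (B :=: V)%MS -> B *m f = diag_mx d *m B ->
    (forall j, j != i -> d 0 j != d 0 i) ->
  (V :&: eigenspace f (d 0 i) :=: row i B)%MS.
Proof.
move=> freeB eqBV eigB simple_i; apply/eqmxP/andP; split; last first.
  rewrite sub_capmx -eqBV row_sub; apply/eigenspaceP.
  by rewrite -row_mul eigB row_mul row_diag_mx -scalemxAl -rowE.
apply/rV_subP => v; rewrite sub_capmx -eqBV.
case/andP => /submxP[c ->] /eigenspaceP.
rewrite -mulmxA eigB mulmxA scalemxAl => /(row_free_inj freeB) eig_c.
have -> : c = c 0 i *: delta_mx 0 i.
  apply/rowP => j; rewrite !mxE /=; have [->|neq_ji] := eqVneq j i.
    by rewrite mulr1.
  have /rowP/(_ j) := eig_c; rewrite mul_mx_diag !mxE mulrC => /eqP.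
  rewrite -subr_eq0 -mulrBl mulf_eq0 subr_eq0 (negPf (simple_i _ neq_ji)) /=.
  by move/eqP->; rewrite mulr0.
by rewrite -scalemxAl -rowE scalemx_sub.
Qed.

(** * Differentials in coordinates *)

Lemma vec4E (R : realType) (x y z w : R) :
  vec4 x y z w = x *: delta_mx 0 0 + y *: delta_mx 0 1
    + z *: delta_mx 0 2 + w *: delta_mx 0 3.
Proof.
apply/rowP => i; rewrite !mxE /=.
by case: i => -[|[|[|[|//]]]] i /=; rewrite ?(mulr0, mulr1, addr0, add0r).
Qed.

Lemma row4E (R : realType) (p : 'rV[R]_4) : p = vec4 (p 0 0) (p 0 1) (p 0 2) (p 0 3).
Proof.
apply/rowP => i; rewrite mxE.
by case: i => -[|[|[|[|//]]]] i /=; congr (p 0 _); apply/val_inj.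
Qed.

Lemma is_diffZl (R : realType) (V W : normedModType R)
    (k dk : V -> R) (w : W) (x : V) :
  is_diff x k dk -> is_diff x (fun z => k z *: w) (fun v => dk v *: w).
Proof.
move=> [kd <-]; apply: DiffDef; first exact: differentiableZl.
by rewrite diffZl.
Qed.

Lemma is_diff_vec4 (R : realType) (V : normedModType R)
    (f0 f1 f2 f3 d0 d1 d2 d3 : V -> R) (x : V) :
    is_diff x f0 d0 -> is_diff x f1 d1 -> is_diff x f2 d2 -> is_diff x f3 d3 ->
  is_diff x (fun q => vec4 (f0 q) (f1 q) (f2 q) (f3 q))
            (fun v => vec4 (d0 v) (d1 v) (d2 v) (d3 v)).
Proof.
move=> h0 h1 h2 h3.
have -> : (fun q => vec4 (f0 q) (f1 q) (f2 q) (f3 q)) =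
  (fun q => f0 q *: delta_mx 0 0) + (fun q => f1 q *: delta_mx 0 1) +
  (fun q => f2 q *: delta_mx 0 2) + (fun q => f3 q *: delta_mx 0 3).
  by apply/funext => q; rewrite vec4E.
have -> : (fun q => vec4 (d0 q) (d1 q) (d2 q) (d3 q)) =
  (fun q => d0 q *: delta_mx 0 0) + (fun q => d1 q *: delta_mx 0 1) +
  (fun q => d2 q *: delta_mx 0 2) + (fun q => d3 q *: delta_mx 0 3).
  by apply/funext => q; rewrite vec4E.
have diffZl (f df : V -> R) (w : 'rV[R]_4) : is_diff x f df ->
    is_diff x (fun z => f z *: w) (fun v => df v *: w).
  exact: is_diffZl.
exact: (is_diffD (is_diffD (is_diffD (diffZl _ _ _ h0) (diffZl _ _ _ h1))
  (diffZl _ _ _ h2)) (diffZl _ _ _ h3)).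
Qed.

Lemma is_diff_coord (R : realType) m n (i : 'I_m) (j : 'I_n) (p : 'M[R]_(m, n)) :
  is_diff p (fun q : 'M[R]_(m, n) => q i j) (fun v => v i j).
Proof.
apply: DiffDef => [|]; first exact: differentiable_coord.
apply/funext => v; rewrite -deriveE; last exact: differentiable_coord.
have := derive_mx (@derivable_id R 'M[R]_(m, n) p v);
rewrite derive_id => /matrixP/(_ i j).
by rewrite mxE.
Qed.

Lemma is_diff_comp_real (R : realType) (V : normedModType R)
    (g : R -> R) (f df : V -> R) (x : V) (g' : R) :
  is_diff x f df -> is_derive (f x) 1 g g' ->
  is_diff x (g \o f) (fun v => g' * df v).
Proof.
move=> hf [gd <-].
have hg : is_diff (f x) g (fun v => 'D_1 g (f x) * v).
  have gdd : differentiable g (f x) by apply/derivable1_diffP.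
  apply: DiffDef => //.
  by apply/funext => v; rewrite deriv1E // derive1E /= mulrC.
exact: is_diff_comp.
Qed.

(** Row vectors are acted upon from the right, so the rows of the jacobian are
    the partial derivatives. *)
Lemma is_diff_jacobian (R : realType) m n (f df : 'rV[R]_m -> 'rV[R]_n)
    p (v : 'rV[R]_m) :
  is_diff p f df -> v *m jacobian f p = df v.
Proof. by move=> [fd <-]; rewrite -deriveEjacobian // deriveE. Qed.

(** * The shape operator of the ellipsoid *)

(** Both the equation of the ellipsoid and the squared norm of its gradient have
    this form. *)
Definition quadform (R : realType) (c d : R) (p : 'rV[R]_4) : R :=
  c * (p 0 0 ^+ 2 + p 0 1 ^+ 2) + d * (p 0 2 ^+ 2 + p 0 3 ^+ 2).

Lemma is_diff_sqr (R : realType) (V : normedModType R) (f df : V -> R) (x : V) :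
  is_diff x f df -> is_diff x (fun q => f q ^+ 2) (fun v => 2 * f x * df v).
Proof. by move=> hf; apply: (is_diff_eq (is_diffX 1 hf)). Qed.

Lemma is_diff_quadform (R : realType) (c d : R) (p : 'rV[R]_4) :
  is_diff p (quadform c d) (fun v =>
    2 * c * (p 0 0 * v 0 0 + p 0 1 * v 0 1)
    + 2 * d * (p 0 2 * v 0 2 + p 0 3 * v 0 3)).
Proof.
have sq (i : 'I_4) : is_diff p (fun q : 'rV[R]_4 => q 0 i ^+ 2)
    (fun v => 2 * p 0 i * v 0 i) by apply: is_diff_sqr; apply: is_diff_coord.
apply: (is_diff_eq (is_diffD (is_diffZ c (is_diffD (sq 0) (sq 1)))
  (is_diffZ d (is_diffD (sq 2) (sq 3))))).
by apply/funext => v; rewrite !fctE /GRing.scale /=; ring.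
Qed.

Lemma is_derive_inv_sqrt (R : realType) (x : R) : 0 < x ->
  is_derive x 1 (fun y : R => (Num.sqrt y)^-1) (- (2 * Num.sqrt x ^+ 3)^-1).
Proof.
move=> x_gt0; have s_neq0 : Num.sqrt x != 0 by rewrite sqrtr_eq0 -ltNge.
have [sd ds] := is_derive1_sqrt x_gt0.
apply: DeriveDef; first exact: derivableV.
rewrite deriveV // ds /GRing.scale /=; field.
by [].
Qed.

Section Ellipsoid.
Variables (R : realType) (a b : R).
Hypotheses (a_neq0 : a != 0) (b_neq0 : b != 0).

Lemma grad_quadric (p : 'rV[R]_4) : grad (quadric a b) p =
  vec4 (2 * p 0 0 / a ^+ 2) (2 * p 0 1 / a ^+ 2)
       (2 * p 0 2 / b ^+ 2) (2 * p 0 3 / b ^+ 2).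
Proof.
have -> : quadric a b = quadform (a ^- 2) (b ^- 2).
  by apply/funext => q; rewrite /quadric /quadform mulrC; congr (_ + _); rewrite mulrC.
have [qd dq] := is_diff_quadform (a ^- 2) (b ^- 2) p.
rewrite /grad [RHS]row4E; apply/rowP => i.
rewrite [LHS]mxE deriveE // dq [RHS]mxE.
case: i => -[|[|[|[|//]]]] i; rewrite !mxE /=; field; exact/andP.
Qed.

Definition gradnorm2 : 'rV[R]_4 -> R := quadform (4 / a ^+ 4) (4 / b ^+ 4).

Lemma enorm_grad (p : 'rV[R]_4) :
  enorm (grad (quadric a b) p) = Num.sqrt (gradnorm2 p).
Proof.
rewrite grad_quadric // /enorm; congr Num.sqrt.
rewrite /dot mxE !big_ord_recl big_ord0 !mxE /= /gradnorm2 /quadform.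
by field; apply/andP.
Qed.

Lemma is_diff_normal (p : 'rV[R]_4) : 0 < gradnorm2 p ->
  let h := Num.sqrt (gradnorm2 p) in
  let dh (v : 'rV[R]_4) := - (4 / h ^+ 3) *
    ((p 0 0 * v 0 0 + p 0 1 * v 0 1) / a ^+ 4
     + (p 0 2 * v 0 2 + p 0 3 * v 0 3) / b ^+ 4) in
  let da (i : 'I_4) (v : 'rV[R]_4) := (v 0 i / h + p 0 i * dh v) * (2 / a ^+ 2) in
  let db (i : 'I_4) (v : 'rV[R]_4) := (v 0 i / h + p 0 i * dh v) * (2 / b ^+ 2) in
  is_diff p (fun q => - inner_normal a b q)
    (fun v => vec4 (da 0 v) (da 1 v) (db 2 v) (db 3 v)).
Proof.
move=> Qp h dh da db.
have h_neq0 : h != 0 by rewrite sqrtr_eq0 -ltNge.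
have hs : is_diff p (fun q => (Num.sqrt (gradnorm2 q))^-1) dh.
  apply: (is_diff_eq (is_diff_comp_real (is_diff_quadform _ _ _)
    (is_derive_inv_sqrt Qp))).
  apply/funext => v; rewrite /dh -/h; field.
  by apply/and3P.
have hc i c : is_diff p
    (fun q : 'rV[R]_4 => (Num.sqrt (gradnorm2 q))^-1 * (2 * q 0 i / c ^+ 2))
    (fun v => (v 0 i / h + p 0 i * dh v) * (2 / c ^+ 2)).
  have hi : is_diff p (fun q : 'rV[R]_4 => q 0 i) (fun v => v 0 i).
    exact: is_diff_coord.
  have -> : (fun q : 'rV[R]_4 =>
       (Num.sqrt (gradnorm2 q))^-1 * (2 * q 0 i / c ^+ 2))
     = (2 / c ^+ 2) *: ((fun q : 'rV[R]_4 => (Num.sqrt (gradnorm2 q))^-1)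
                        * (fun q => q 0 i)).
    by apply/funext => q; rewrite !fctE /GRing.scale /=; ring.
  apply: (is_diff_eq (is_diffZ _ (is_diffM hs hi))).
  by apply/funext => v; rewrite !fctE /GRing.scale /= -/h; ring.
have -> : (fun q => - inner_normal a b q) = (fun q => vec4
    ((Num.sqrt (gradnorm2 q))^-1 * (2 * q 0 0 / a ^+ 2))
    ((Num.sqrt (gradnorm2 q))^-1 * (2 * q 0 1 / a ^+ 2))
    ((Num.sqrt (gradnorm2 q))^-1 * (2 * q 0 2 / b ^+ 2))
    ((Num.sqrt (gradnorm2 q))^-1 * (2 * q 0 3 / b ^+ 2))).
  apply/funext => q; rewrite /inner_normal opprK enorm_grad grad_quadric //.
  apply/rowP => i; rewrite !mxE.
  by case: i => -[|[|[|[|//]]]] i.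
exact: is_diff_vec4.
Qed.

(** The letters [al], [be] stand for cos u, sin u and [ga], [de] for
    cos v, sin v.  Keeping the direction of (x, y) as data, instead of dividing
    by the norm of (x, y), makes the frame below available also on the two
    circles [C = 0] and [S = 0]. *)
Definition torus_pt (C S al be ga de : R) : 'rV[R]_4 :=
  vec4 (a * C * al) (a * C * be) (b * S * ga) (b * S * de).

(** The velocities of the rotation of the (x, y)-plane, of the meridian ellipse
    and of the rotation of the (z, w)-plane, the first and the third one
    normalized. *)
Definition frame (C S al be ga de : R) : 'M[R]_(3, 4) :=
  \matrix_(i < 3) [:: vec4 (- be) al 0 0;
    vec4 (- (a * S * al)) (- (a * S * be)) (b * C * ga) (b * C * de);
    vec4 0 0 (- de) ga]`_i.

Variables (C S al be ga de : R).
Hypotheses (CS1 : C ^+ 2 + S ^+ 2 = 1) (al1 : al ^+ 2 + be ^+ 2 = 1)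
  (ga1 : ga ^+ 2 + de ^+ 2 = 1).
Let p := torus_pt C S al be ga de.
Let B := frame C S al be ga de.

Lemma mul_frame (v : 'rV[R]_3) : v *m B =
  vec4 (v 0 0 * - be - v 0 1 * (a * S * al)) (v 0 0 * al - v 0 1 * (a * S * be))
       (v 0 1 * (b * C * ga) - v 0 2 * de) (v 0 1 * (b * C * de) + v 0 2 * ga).
Proof.
rewrite [LHS]row4E !mxE !big_ord_recl !big_ord0 !mxE /=.
have -> : lift ord0 ord0 = 1 :> 'I_3 by apply/val_inj.
have -> : lift ord0 (lift ord0 ord0) = 2 :> 'I_3 by apply/val_inj.
have -> : ord0 = 0 :> 'I_3 by [].
by congr vec4; ring.
Qed.

Lemma frame_free : row_free B.
Proof.
apply: inj_row_free => v; rewrite mul_frame => /rowP vB0.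
have := (vB0 0, vB0 1, vB0 2, vB0 3).
rewrite !mxE /= => -[[[e0 e1] e2] e3].
(* Each coordinate is recovered by pairing with a dual frame. *)
have v0 : v 0 0 = 0.
  have -> : v 0 0 = al * (v 0 0 * al - v 0 1 * (a * S * be))
    - be * (v 0 0 * - be - v 0 1 * (a * S * al))
    + v 0 0 * (1 - (al ^+ 2 + be ^+ 2)) by ring.
  by rewrite e0 e1 al1 subrr !mulr0 subrr addr0.
have v2 : v 0 2 = 0.
  have -> : v 0 2 = ga * (v 0 1 * (b * C * de) + v 0 2 * ga)
    - de * (v 0 1 * (b * C * ga) - v 0 2 * de)
    + v 0 2 * (1 - (ga ^+ 2 + de ^+ 2)) by ring.
  by rewrite e2 e3 ga1 subrr !mulr0 subrr addr0.
have v1 : v 0 1 = 0.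
  rewrite v0 v2 in e0 e1 e2 e3.
  have -> : v 0 1 = C * (ga * (v 0 1 * (b * C * ga) - 0 * de)
        + de * (v 0 1 * (b * C * de) + 0 * ga)) / b
    - S * (al * (0 * - be - v 0 1 * (a * S * al))
        + be * (0 * al - v 0 1 * (a * S * be))) / a
    + v 0 1 * (C ^+ 2 * (1 - (ga ^+ 2 + de ^+ 2))
        + S ^+ 2 * (1 - (al ^+ 2 + be ^+ 2)) + (1 - (C ^+ 2 + S ^+ 2))).
    by field; apply/andP.
  by rewrite e0 e1 e2 e3 al1 ga1 CS1 subrr !(mulr0, mul0r, addr0, subrr).
apply/rowP => i; rewrite mxE.
case: i => -[|[|[|//]]] i; [rewrite -[RHS]v0|rewrite -[RHS]v1|rewrite -[RHS]v2];
  by congr (v 0 _); apply/val_inj.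
Qed.

Lemma gradnorm2_torus : gradnorm2 p = 4 * (C ^+ 2 / a ^+ 2 + S ^+ 2 / b ^+ 2).
Proof.
rewrite /gradnorm2 /quadform !mxE /=.
have -> : (a * C * al) ^+ 2 + (a * C * be) ^+ 2
    = a ^+ 2 * C ^+ 2 * (al ^+ 2 + be ^+ 2) by ring.
have -> : (b * S * ga) ^+ 2 + (b * S * de) ^+ 2
    = b ^+ 2 * S ^+ 2 * (ga ^+ 2 + de ^+ 2) by ring.
by rewrite al1 ga1; field; apply/andP.
Qed.

Lemma gradnorm2_gt0 : 0 < gradnorm2 p.
Proof.
rewrite gradnorm2_torus pmulr_rgt0 //.
have pa : 0 < a ^+ 2 by rewrite exprn_even_gt0.
have pb : 0 < b ^+ 2 by rewrite exprn_even_gt0.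
have [C0|C0] := eqVneq C 0.
  have S1 : S ^+ 2 = 1 by rewrite -CS1 C0 expr0n add0r.
  by rewrite C0 S1 expr0n mul0r add0r divr_gt0.
by rewrite ltr_pwDl ?divr_ge0 ?divr_gt0 ?sqr_ge0 ?(ltW pb) // exprn_even_gt0.
Qed.

Let h := Num.sqrt (gradnorm2 p).

Lemma gradnorm_gt0 : 0 < h. Proof. by rewrite sqrtr_gt0 gradnorm2_gt0. Qed.

Lemma gradnorm_sqr : h ^+ 2 = 4 * (C ^+ 2 / a ^+ 2 + S ^+ 2 / b ^+ 2).
Proof.
by rewrite sqr_sqrtr ?gradnorm2_torus // -gradnorm2_torus ltW ?gradnorm2_gt0.
Qed.

Definition curvatures : 'rV[R]_3 :=
  \row_i [:: 2 / (a ^+ 2 * h); 8 / (a ^+ 2 * b ^+ 2 * h ^+ 3); 2 / (b ^+ 2 * h)]`_i.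

(** Along the two rotation vectors the derivative of 1 / h vanishes, so D(-N)
    acts on them as the linear gradient map divided by h.  On the meridian
    vector the derivative of 1 / h contributes; in each coordinate the sum
    simplifies once h^2 is expressed with C only or with S only. *)
Lemma frame_shape : B *m Defs.shape (inner_normal a b) p = diag_mx curvatures *m B.
Proof.
apply/row_matrixP => i; rewrite !row_mul row_diag_mx -scalemxAl -rowE.
rewrite /Defs.shape (is_diff_jacobian _ (is_diff_normal gradnorm2_gt0)) -/h.
have hn0 : h != 0 by rewrite gt_eqF ?gradnorm_gt0.
rewrite rowK [curvatures _ _]mxE.
(* 1 / h is put over the denominator h^3 of the derivative of 1 / h; the two
   forms of h^2 serve for the (x, y) and the (z, w) coordinates. *)
have ha : h^-1 = (4 / b ^+ 2 - 4 * C ^+ 2 * (b ^- 2 - a ^- 2)) / h ^+ 3.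
  have -> : 4 / b ^+ 2 - 4 * C ^+ 2 * (b ^- 2 - a ^- 2) = h ^+ 2.
    by rewrite gradnorm_sqr -[4 / b ^+ 2]mulr1 -CS1; field; apply/andP.
  by field.
have hb : h^-1 = (4 / a ^+ 2 + 4 * S ^+ 2 * (b ^- 2 - a ^- 2)) / h ^+ 3.
  have -> : 4 / a ^+ 2 + 4 * S ^+ 2 * (b ^- 2 - a ^- 2) = h ^+ 2.
    by rewrite gradnorm_sqr -[4 / a ^+ 2]mulr1 -CS1; field; apply/andP.
  by field.
case: i => -[|[|[|//]]] i /=; rewrite [RHS]row4E !mxE /=.
- by congr vec4; field; rewrite ?hn0 ?a_neq0 ?b_neq0.
- have -> : (a * C * al * - (a * S * al) + a * C * be * - (a * S * be)) / a ^+ 4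
      + (b * S * ga * (b * C * ga) + b * S * de * (b * C * de)) / b ^+ 4
    = C * S * ((ga ^+ 2 + de ^+ 2) / b ^+ 2 - (al ^+ 2 + be ^+ 2) / a ^+ 2).
    by field; apply/andP.
  rewrite al1 ga1; congr vec4.
  + by rewrite ha; field; rewrite ?hn0 ?a_neq0 ?b_neq0.
  + by rewrite ha; field; rewrite ?hn0 ?a_neq0 ?b_neq0.
  + by rewrite hb; field; rewrite ?hn0 ?a_neq0 ?b_neq0.
  + by rewrite hb; field; rewrite ?hn0 ?a_neq0 ?b_neq0.
- by congr vec4; field; rewrite ?hn0 ?a_neq0 ?b_neq0.
Qed.

(** The frame is orthogonal to the gradient, and a hyperplane has dimension
    three. *)
Lemma frame_tangent : (B :=: tangent (inner_normal a b) p)%MS.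
Proof.
have BT : (B <= tangent (inner_normal a b) p)%MS.
  apply/sub_kermxP/row_matrixP => i.
  rewrite row_mul rowK row0 /inner_normal enorm_grad grad_quadric //.
  set e := nth _ _ _; rewrite linearN mulmxN linearZ /= -scalemxAr.
  set w := e *m _; suff -> : w = 0 by rewrite scaler0 oppr0.
  rewrite {}/w {}/e; apply/matrixP => k l.
  rewrite !ord1 !mxE !big_ord_recl big_ord0 !mxE /=.
  case: i => -[|[|[|//]]] i /=; rewrite !mxE /=;
    [by field; rewrite ?a_neq0 ?b_neq0| |by field; rewrite ?a_neq0 ?b_neq0].
  transitivity (2 * C * S * ((ga ^+ 2 + de ^+ 2) - (al ^+ 2 + be ^+ 2))).
    by field; apply/andP.
  by rewrite al1 ga1 subrr mulr0.
have NT : \rank (tangent (inner_normal a b) p) = 3.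
  rewrite mxrank_ker mxrank_tr rank_rV.
  suff -> : inner_normal a b p != 0 by [].
  rewrite oppr_eq0 scaler_eq0 invr_eq0 enorm_grad gt_eqF ?gradnorm_gt0 //=.
  apply/eqP => g0; have := enorm_grad p; rewrite g0 /enorm /dot mul0mx mxE sqrtr0.
  by move/eqP; rewrite eq_sym gt_eqF ?gradnorm_gt0.
apply/eqmxP; rewrite -(mxrank_leqif_eq BT) NT; exact: frame_free.
Qed.

End Ellipsoid.

(** * Principal curvatures and eigenlines *)

Section Curvatures.
Variables (R : realType) (a b : R).
Hypotheses (b_gt0 : 0 < b) (ab : b < a).

Lemma axes_neq0 : a != 0 /\ b != 0.
Proof. by split; rewrite gt_eqF ?(lt_trans b_gt0 ab). Qed.

Variables (C S al be ga de : R).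
Hypotheses (CS1 : C ^+ 2 + S ^+ 2 = 1) (al1 : al ^+ 2 + be ^+ 2 = 1)
  (ga1 : ga ^+ 2 + de ^+ 2 = 1).
Local Notation p := (torus_pt a b C S al be ga de).
Local Notation B := (frame a b C S al be ga de).
Local Notation N := (inner_normal a b).
Local Notation M := (ellipsoid a b).
Local Notation k := (curvatures a b C S al be ga de).

(** The whole stratification follows from these two gaps: after factoring they
    compare h^2 with its extreme values 4 / b^2 (at C = 0) and 4 / a^2
    (at S = 0). *)
Lemma curvatures_gap : exists e1 e2 : R, [/\ 0 < e1, 0 < e2,
  k 0 1 - k 0 0 = e1 * C ^+ 2 & k 0 2 - k 0 1 = e2 * S ^+ 2].
Proof.
have [a_neq0 b_neq0] := axes_neq0.
have h_gt0 := gradnorm_gt0 a_neq0 b_neq0 CS1 al1 ga1.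
have h_sqr := gradnorm_sqr a_neq0 b_neq0 CS1 al1 ga1.
rewrite !mxE /=; set h := Num.sqrt _ in h_gt0 h_sqr *.
have h_neq0 : h != 0 by rewrite gt_eqF.
have a_gt0 := lt_trans b_gt0 ab.
pose e := b ^- 2 - a ^- 2.
have e_gt0 : 0 < e.
  by rewrite subr_gt0 ltf_pV2 ?posrE ?exprn_gt0 // ltrXn2r // ltW.
exists (8 * e / (a ^+ 2 * h ^+ 3)), (8 * e / (b ^+ 2 * h ^+ 3)).
have pos c : 0 < c -> 0 < 8 * e / (c ^+ 2 * h ^+ 3).
  by move=> c_gt0; rewrite divr_gt0 ?mulr_gt0 ?exprn_gt0.
split; try exact: pos.
- transitivity (2 / (a ^+ 2 * h ^+ 3) * (4 / b ^+ 2 * (C ^+ 2 + S ^+ 2) - h ^+ 2)).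
    by rewrite CS1; field; rewrite ?h_neq0 ?a_neq0 ?b_neq0.
  by rewrite h_sqr /e; field; rewrite ?h_neq0 ?a_neq0 ?b_neq0.
- transitivity (2 / (b ^+ 2 * h ^+ 3) * (h ^+ 2 - 4 / a ^+ 2 * (C ^+ 2 + S ^+ 2))).
    by rewrite CS1; field; rewrite ?h_neq0 ?a_neq0 ?b_neq0.
  by rewrite h_sqr /e; field; rewrite ?h_neq0 ?a_neq0 ?b_neq0.
Qed.

Lemma principal_curvatures_torus :
  principal_curvatures N p = [:: k 0 0; k 0 1; k 0 2].
Proof.
have [a_neq0 b_neq0] := axes_neq0.
have kE : char_poly (restrictmx (tangent N p) (Defs.shape N p)) =
    \prod_(x <- [:: k 0 0; k 0 1; k 0 2]) ('X - x%:P).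
  rewrite (char_poly_restrictmx (frame_free a_neq0 b_neq0 CS1 al1 ga1)
    (frame_tangent a_neq0 b_neq0 CS1 al1 ga1)
    (frame_shape a_neq0 b_neq0 CS1 al1 ga1)).
  rewrite !big_ord_recl big_ord0 !big_cons big_nil.
  by do 3?[congr (_ * _)] => //; congr ('X - (k 0 _)%:P) => //; apply/val_inj.
have k_sorted : sorted <=%R [:: k 0 0; k 0 1; k 0 2].
  have [e1 [e2 [e1_gt0 e2_gt0 k21 k32]]] := curvatures_gap.
  rewrite /= andbT; apply/andP; split; rewrite -subr_ge0.
    by rewrite k21 mulr_ge0 ?sqr_ge0 // ltW.
  by rewrite k32 mulr_ge0 ?sqr_ge0 // ltW.
apply: xget_unique => // s [s_sorted]; rewrite kE => /esym.
exact: sorted_roots_unique.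
Qed.

Lemma curvatures_torus :
  [/\ curvature N 1 p = k 0 0, curvature N 2 p = k 0 1
    & curvature N 3 p = k 0 2].
Proof. by rewrite /curvature principal_curvatures_torus. Qed.

Lemma curvature12 : (curvature N 1 p = curvature N 2 p <-> C = 0) /\
  (curvature N 1 p < curvature N 2 p <-> C != 0).
Proof.
have [-> -> _] := curvatures_torus.
have [e1 [_ [e1_gt0 _ k21 _]]] := curvatures_gap.
rewrite -subr_gt0 k21 pmulr_rgt0 // exprn_even_gt0 //=.
split=> //; split=> [k12|C0]; last first.
  by apply/eqP; rewrite eq_sym -subr_eq0 k21 C0 expr0n mulr0.
by move/eqP: k21; rewrite k12 subrr eq_sym mulf_eq0 gt_eqF //= sqrf_eq0 => /eqP.
Qed.

Lemma curvature23 : (curvature N 2 p = curvature N 3 p <-> S = 0) /\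
  (curvature N 2 p < curvature N 3 p <-> S != 0).
Proof.
have [_ -> ->] := curvatures_torus.
have [_ [e2 [_ e2_gt0 _ k32]]] := curvatures_gap.
rewrite -subr_gt0 k32 pmulr_rgt0 // exprn_even_gt0 //=.
split=> //; split=> [k23|S0]; last first.
  by apply/eqP; rewrite eq_sym -subr_eq0 k32 S0 expr0n mulr0.
by move/eqP: k32; rewrite k23 subrr eq_sym mulf_eq0 gt_eqF //= sqrf_eq0 => /eqP.
Qed.

Lemma ord3P (i : 'I_3) : [\/ i = 0, i = 1 | i = 2].
Proof.
case: i => -[|[|[|//]]] i;
  [by constructor 1; apply/val_inj|by constructor 2; apply/val_inj|
   by constructor 3; apply/val_inj].
Qed.

Lemma eigenline_torus :
  [/\ C != 0 -> (eigenline N 1 p :=: row 0 B)%MS,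
      C != 0 -> S != 0 -> (eigenline N 2 p :=: row 1 B)%MS
    & S != 0 -> (eigenline N 3 p :=: row 2 B)%MS].
Proof.
have [a_neq0 b_neq0] := axes_neq0.
have [e1 [e2 [e1_gt0 e2_gt0 k21 k32]]] := curvatures_gap.
have k01 : C != 0 -> k 0 0 < k 0 1.
  by move=> C0; rewrite -subr_gt0 k21 pmulr_rgt0 // exprn_even_gt0.
have k12 : S != 0 -> k 0 1 < k 0 2.
  by move=> S0; rewrite -subr_gt0 k32 pmulr_rgt0 // exprn_even_gt0.
have k01' : k 0 0 <= k 0 1 by rewrite -subr_ge0 k21 mulr_ge0 ?sqr_ge0 // ltW.
have k12' : k 0 1 <= k 0 2 by rewrite -subr_ge0 k32 mulr_ge0 ?sqr_ge0 // ltW.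
have simple i := eigenline_simple (i := i)
  (frame_free a_neq0 b_neq0 CS1 al1 ga1)
  (frame_tangent a_neq0 b_neq0 CS1 al1 ga1)
  (frame_shape a_neq0 b_neq0 CS1 al1 ga1).
rewrite /eigenline; have [-> -> ->] := curvatures_torus.
split=> [/k01 lt01|/k01 lt01 /k12 lt12|/k12 lt12]; apply: simple => j.
- have [->|->|->] := ord3P j; rewrite ?eqxx // => _; first by rewrite gt_eqF.
  by rewrite gt_eqF // (lt_le_trans lt01).
- have [->|->|->] := ord3P j; rewrite ?eqxx // => _; first by rewrite lt_eqF.
  by rewrite gt_eqF.
- have [->|->|->] := ord3P j; rewrite ?eqxx // => _; last by rewrite lt_eqF.
  by rewrite lt_eqF // (le_lt_trans _ lt12).
Qed.

End Curvatures.

(** * The umbilic, partially umbilic and singular sets *)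

Lemma unit_angle (R : realType) (x y : R) : x ^+ 2 + y ^+ 2 = 1 ->
  exists t, x = cos t /\ y = sin t.
Proof.
move=> xy1; have x1 : -1 <= x <= 1.
  rewrite -ler_norml -(@expr_le1 _ 2) // real_normK ?num_real //.
  by rewrite -xy1 lerDl sqr_ge0.
have yE : 1 - x ^+ 2 = y ^+ 2 by rewrite -xy1 addrAC subrr add0r.
have [y0|y0] := leP 0 y.
- exists (acos x); rewrite acosK ?in_itv //= sin_acos // yE sqrtr_sqr.
  by rewrite ger0_norm.
- exists (- acos x); rewrite cosN sinN acosK ?in_itv //= sin_acos // yE sqrtr_sqr.
  by rewrite ltr0_norm // opprK.
Qed.

(** A unit direction exists also for the zero vector, where it is arbitrary. *)
Lemma polar (R : realType) (x y : R) : exists r al be : R,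
  [/\ 0 <= r, al ^+ 2 + be ^+ 2 = 1, x = r * al & y = r * be].
Proof.
have ge0 : 0 <= x ^+ 2 + y ^+ 2 by rewrite addr_ge0 ?sqr_ge0.
have [r0|r0] := eqVneq (x ^+ 2 + y ^+ 2) 0.
  exists 0, 1, 0; rewrite expr1n expr0n addr0 !mul0r; split=> //.
    by move/eqP: r0; rewrite paddr_eq0 ?sqr_ge0 // sqrf_eq0 => /andP[/eqP].
  by move/eqP: r0; rewrite paddr_eq0 ?sqr_ge0 // !sqrf_eq0 => /andP[_ /eqP].
have s0 : Num.sqrt (x ^+ 2 + y ^+ 2) != 0.
  by rewrite sqrtr_eq0 -ltNge lt_neqAle eq_sym r0.
exists (Num.sqrt (x ^+ 2 + y ^+ 2)), (x / Num.sqrt (x ^+ 2 + y ^+ 2)),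
  (y / Num.sqrt (x ^+ 2 + y ^+ 2)).
split; [exact: sqrtr_ge0| |by field|by field].
by rewrite !exprMn !exprVn sqr_sqrtr // -mulrDl divff.
Qed.

Section Strata.
Variables (R : realType) (a b : R).
Hypotheses (b_gt0 : 0 < b) (ab : b < a).
Local Notation N := (inner_normal a b).
Local Notation M := (ellipsoid a b).

Lemma ellipsoid_torus (C S al be ga de : R) : C ^+ 2 + S ^+ 2 = 1 ->
    al ^+ 2 + be ^+ 2 = 1 -> ga ^+ 2 + de ^+ 2 = 1 ->
  M (torus_pt a b C S al be ga de).
Proof.
have [a_neq0 b_neq0] := axes_neq0 b_gt0 ab.
move=> CS1 al1 ga1; rewrite /M /= /quadric !mxE /=.
transitivity (C ^+ 2 * (al ^+ 2 + be ^+ 2) + S ^+ 2 * (ga ^+ 2 + de ^+ 2)).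
  by field; rewrite ?a_neq0 ?b_neq0.
by rewrite al1 ga1 !mulr1.
Qed.

Lemma ellipsoidP (p : 'rV[R]_4) : M p -> exists C S al be ga de : R,
  [/\ [/\ 0 <= C, 0 <= S & C ^+ 2 + S ^+ 2 = 1],
      al ^+ 2 + be ^+ 2 = 1, ga ^+ 2 + de ^+ 2 = 1
    & p = torus_pt a b C S al be ga de].
Proof.
have [a_neq0 b_neq0] := axes_neq0 b_gt0 ab.
have [r [al [be [r0 al1 p0 p1]]]] := polar (p 0 0) (p 0 1).
have [s [ga [de [s0 ga1 p2 p3]]]] := polar (p 0 2) (p 0 3).
move=> Mp; exists (r / a), (s / b), al, be, ga, de; split=> //; last first.
  by rewrite [p]row4E p0 p1 p2 p3 /torus_pt ![_ * (_ / _)]mulrC !divfK.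
split; [by rewrite divr_ge0 // ltW // (lt_trans b_gt0)|by rewrite divr_ge0 // ltW|].
rewrite -[RHS]Mp /quadric p0 p1 p2 p3 !exprMn -!mulrDr al1 ga1 !mulr1.
by rewrite !exprVn.
Qed.

Section TorusPoint.
Variables C S al be ga de : R.
Hypotheses (CS1 : C ^+ 2 + S ^+ 2 = 1) (al1 : al ^+ 2 + be ^+ 2 = 1)
  (ga1 : ga ^+ 2 + de ^+ 2 = 1).
Local Notation p := (torus_pt a b C S al be ga de).

Lemma strata_torus : [/\ ~ umbilic M N p, P12 M N p <-> C = 0
  & P23 M N p <-> S = 0].
Proof.
have Mp := ellipsoid_torus CS1 al1 ga1.
have [eq12 lt12] := curvature12 b_gt0 ab CS1 al1 ga1.
have [eq23 lt23] := curvature23 b_gt0 ab CS1 al1 ga1.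
have CS0 : C = 0 -> S != 0.
  move=> C0; apply/eqP => S0; move/eqP: CS1.
  by rewrite C0 S0 expr0n addr0 eq_sym oner_eq0.
split.
- by case=> _ /eq12 /CS0 /eqP S0 /eq23.
- split=> [[_ /eq12]|C0] //; split=> //; [exact/eq12|exact/lt23/CS0].
- split=> [[_ _ /eq23]|S0] //; split=> //; [|exact/eq23].
  by apply/lt12/eqP => /CS0; rewrite S0 eqxx.
Qed.
End TorusPoint.

Lemma umbilic_empty : umbilic M N = set0.
Proof.
apply/seteqP; split=> // p up.
have [Mp _ _] := up.
have [C [S [al [be [ga [de [[_ _ CS1] al1 ga1 pE]]]]]]] := ellipsoidP Mp.
by have [nu _ _] := strata_torus CS1 al1 ga1; apply: nu; rewrite -pE.
Qed.

Lemma P12_circle :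
  P12 M N = range (fun v : R => vec4 0 0 (b * cos v) (b * sin v)).
Proof.
apply/seteqP; split=> p.
- move=> Pp; have [Mp _ _] := Pp.
  have [C [S [al [be [ga [de [[_ S0 CS1] al1 ga1 pE]]]]]]] := ellipsoidP Mp.
  have [_ p12 _] := strata_torus CS1 al1 ga1.
  have C0 : C = 0 by apply/p12; rewrite -pE.
  have S1 : S = 1.
    by apply/eqP; rewrite -(@eqrXn2 _ 2) // expr1n -CS1 C0 expr0n add0r.
  have [v [gaE deE]] := unit_angle ga1.
  by exists v => //; rewrite pE /torus_pt C0 S1 gaE deE !(mulr1, mulr0, mul0r).
- case=> v _ <-.
  have -> : vec4 0 0 (b * cos v) (b * sin v)
      = torus_pt a b 0 1 1 0 (cos v) (sin v).
    by rewrite /torus_pt !(mulr1, mulr0, mul0r).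
  have [|||_ p12 _] := @strata_torus 0 1 1 0 (cos v) (sin v).
  + by rewrite expr0n expr1n add0r.
  + by rewrite expr0n expr1n addr0.
  + exact: cos2Dsin2.
  + exact/p12.
Qed.

Lemma P23_circle :
  P23 M N = range (fun u : R => vec4 (a * cos u) (a * sin u) 0 0).
Proof.
apply/seteqP; split=> p.
- move=> Pp; have [Mp _ _] := Pp.
  have [C [S [al [be [ga [de [[C0 _ CS1] al1 ga1 pE]]]]]]] := ellipsoidP Mp.
  have [_ _ p23] := strata_torus CS1 al1 ga1.
  have S0 : S = 0 by apply/p23; rewrite -pE.
  have C1 : C = 1.
    by apply/eqP; rewrite -(@eqrXn2 _ 2) // expr1n -CS1 S0 expr0n addr0.
  have [u [alE beE]] := unit_angle al1.
  by exists u => //; rewrite pE /torus_pt S0 C1 alE beE !(mulr1, mulr0, mul0r).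
- case=> u _ <-.
  have -> : vec4 (a * cos u) (a * sin u) 0 0
      = torus_pt a b 1 0 (cos u) (sin u) 1 0.
    by rewrite /torus_pt !(mulr1, mulr0, mul0r).
  have [|||_ _ p23] := @strata_torus 1 0 (cos u) (sin u) 1 0.
  + by rewrite expr0n expr1n addr0.
  + exact: cos2Dsin2.
  + by rewrite expr0n expr1n addr0.
  + exact/p23.
Qed.

Lemma foliation_singE :
  [/\ foliation_sing M N 2 = P12 M N `|` P23 M N,
      foliation_sing M N 1 = P12 M N
    & foliation_sing M N 3 = P23 M N].
Proof. by rewrite /foliation_sing umbilic_empty !set0U. Qed.

End Strata.

(** * Curves in Euclidean space *)

Lemma is_derive_0_itv (R : realType) (f : R -> R) (s t x y : R) :
    (forall u, u \in `]s, t[ -> is_derive u 1 f 0) ->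
  x \in `]s, t[ -> y \in `]s, t[ -> f x = f y.
Proof.
move=> df0; wlog le_xy : x y / x <= y.
  by move=> W xI yI; have [/W->|/ltW/W->] := leP x y.
rewrite !in_itv /= => /andP[sx _] /andP[_ yt].
have sub u : u \in `[x, y] -> u \in `]s, t[.
  rewrite !in_itv /= => /andP[xu uy].
  by rewrite (lt_le_trans sx xu) (le_lt_trans uy yt).
have df u : u \in `]x, y[ -> is_derive u 1 f ((fun=> 0) u).
  by rewrite in_itv /= => /andP[/ltW xu /ltW uy]; apply/df0/sub; rewrite in_itv /= xu.
have cf : {within `[x, y], continuous f}.
  by apply: derivable_within_continuous => u /sub /df0 [].
have [c _] := MVT_segment le_xy df cf.
by rewrite mul0r => /eqP; rewrite subr_eq0 => /eqP.
Qed.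

Lemma is_derive_coord (R : realType) (m n : nat) (c : R -> 'M[R]_(m, n))
    (u : R) i j :
  derivable c u 1 -> is_derive u 1 (fun t => c t i j) (derive1 c u i j).
Proof.
move=> dc; apply: DeriveDef; first exact: (derivable_mxP _ _ _).1.
by rewrite derive1E derive_mx // mxE.
Qed.

(** The derivative of a direction is proportional to the cross product of
    position and velocity. *)
Lemma is_derive_direction (R : realType) (x y : R -> R) (u dx dy : R) :
    is_derive u 1 x dx -> is_derive u 1 y dy -> dx * y u = dy * x u ->
    0 < x u ^+ 2 + y u ^+ 2 ->
  is_derive u 1 (fun t => x t * (Num.sqrt (x t ^+ 2 + y t ^+ 2))^-1) 0.
Proof.
move=> hx hy wedge0 r2_gt0.
have hr : is_derive u 1 (fun t => x t ^+ 2 + y t ^+ 2) (2 * (x u * dx + y u * dy)).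
  apply: (is_derive_eq (is_deriveD (is_deriveX 2 hx) (is_deriveX 2 hy))).
  by rewrite /GRing.scale /=; ring.
have hs := @is_derive1_comp R (fun z : R => (Num.sqrt z)^-1)
  (fun t => x t ^+ 2 + y t ^+ 2) u _ _
  (is_derive_inv_sqrt r2_gt0) hr.
apply: (is_derive_eq (is_deriveM hx hs)).
rewrite /GRing.scale /=; set r := Num.sqrt _.
have r_neq0 : r != 0 by rewrite sqrtr_eq0 -ltNge.
have rV : r^-1 = (x u ^+ 2 + y u ^+ 2) / r ^+ 3.
  by rewrite -(sqr_sqrtr (ltW r2_gt0)) -/r; field.
rewrite rV; transitivity ((dx * y u - dy * x u) * y u / r ^+ 3); first by field.
by rewrite wedge0 subrr !mul0r.
Qed.

(** The velocity of an ellipse is written as a point of another ellipse, centred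
    at the origin, so that its own regularity needs no further argument. *)
Lemma is_derive_ellipse (R : realType) (n : nat) (c e1 e2 : 'rV[R]_n) (r1 r2 u : R) :
  is_derive u 1 (ellipse_point c e1 e2 r1 r2) (ellipse_point 0 e2 e1 r2 (- r1) u).
Proof.
have dl (f : R -> R) df (e : 'rV[R]_n) : is_derive u 1 f df ->
    is_derive u 1 (fun t => f t *: e) (df *: e).
  move=> [fd <-]; have fd' : differentiable f u by apply/derivable1_diffP.
  have [gd dg] := is_diffZl e (differentiableP fd').
  apply: DeriveDef; first by apply/derivable1_diffP.
  by rewrite deriveE // dg deriveE.
have h1 := dl _ _ e1 (is_deriveZ r1 (is_derive_cos u)).
have h2 := dl _ _ e2 (is_deriveZ r2 (is_derive_sin u)).
apply: (is_derive_eq (is_deriveD (is_deriveD (is_derive_cst c u 1) h1) h2)).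
by rewrite /ellipse_point /GRing.scale /= mulrN mulNr !add0r addrC.
Qed.

Lemma derive1_ellipse (R : realType) (n : nat) (c e1 e2 : 'rV[R]_n) (r1 r2 : R) :
  derive1 (ellipse_point c e1 e2 r1 r2) = ellipse_point 0 e2 e1 r2 (- r1).
Proof.
apply/funext => u; rewrite derive1E.
by have [_ <-] := is_derive_ellipse c e1 e2 r1 r2 u.
Qed.

Lemma derivable_ellipse (R : realType) (n : nat) (c e1 e2 : 'rV[R]_n) (r1 r2 u : R) :
  derivable (ellipse_point c e1 e2 r1 r2) u 1.
Proof. exact: (@ex_derive _ _ _ _ _ _ _ (is_derive_ellipse c e1 e2 r1 r2 u)). Qed.

Lemma continuous_ellipse (R : realType) (n : nat) (c e1 e2 : 'rV[R]_n) (r1 r2 : R) :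
  continuous (ellipse_point c e1 e2 r1 r2).
Proof.
by move=> u; apply/differentiable_continuous/derivable1_diffP/derivable_ellipse.
Qed.

(** * The leaves *)

Lemma ellipse4E (R : realType) (x0 x1 x2 x3 y0 y1 y2 y3 z0 z1 z2 z3 r1 r2 t : R) :
  ellipse_point (vec4 x0 x1 x2 x3) (vec4 y0 y1 y2 y3) (vec4 z0 z1 z2 z3) r1 r2 t
  = vec4 (x0 + r1 * cos t * y0 + r2 * sin t * z0)
         (x1 + r1 * cos t * y1 + r2 * sin t * z1)
         (x2 + r1 * cos t * y2 + r2 * sin t * z2)
         (x3 + r1 * cos t * y3 + r2 * sin t * z3).
Proof. by rewrite [LHS]row4E !mxE. Qed.

Lemma vec4_0 (R : realType) : vec4 0 0 0 0 = 0 :> 'rV[R]_4.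
Proof. by rewrite [RHS]row4E !mxE. Qed.

Lemma dot_vec4 (R : realType) (x0 x1 x2 x3 y0 y1 y2 y3 : R) :
  dot (vec4 x0 x1 x2 x3) (vec4 y0 y1 y2 y3) = x0 * y0 + x1 * y1 + x2 * y2 + x3 * y3.
Proof. by rewrite /dot mxE !big_ord_recl big_ord0 !mxE /= addr0 !addrA. Qed.

Lemma dotC (R : realType) (n : nat) (u v : 'rV[R]_n) : dot u v = dot v u.
Proof. by rewrite /dot -[LHS]trace_mx11 -mxtrace_tr trmx_mul trmxK trace_mx11. Qed.

Lemma ellipse_velocity_neq0 (R : realType) (n : nat) (c e1 e2 : 'rV[R]_n)
    (r1 r2 t : R) :
    orthonormal2 e1 e2 -> r1 != 0 -> r2 != 0 ->
  derive1 (ellipse_point c e1 e2 r1 r2) t != 0.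
Proof.
case=> e11 e22 e12 r1_neq0 r2_neq0; rewrite derive1_ellipse; apply/eqP => v0.
have e21 : dot e2 e1 = 0 by rewrite dotC.
have dotE w : dot (ellipse_point 0 e2 e1 r2 (- r1) t) w =
    r2 * cos t * dot e2 w - r1 * sin t * dot e1 w.
  by rewrite /dot /ellipse_point add0r mulmxDl -!scalemxAl !mxE !mulNr.
have := (dotE e1, dotE e2).
rewrite v0 e11 e22 e12 e21 /dot !mul0mx !mxE !(mulr0, mulr1, sub0r, subr0).
case=> /esym/eqP; rewrite oppr_eq0 mulf_eq0 (negPf r1_neq0) /= => /eqP s0.
move=> /esym/eqP; rewrite mulf_eq0 (negPf r2_neq0) /= => /eqP c0.
by have /eqP := cos2Dsin2 t; rewrite s0 c0 expr0n addr0 eq_sym oner_eq0.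
Qed.

Section Leaves.
Variables (R : realType) (a b : R).
Hypotheses (b_gt0 : 0 < b) (ab : b < a).
Local Notation N := (inner_normal a b).
Local Notation M := (ellipsoid a b).

(** These equations say that x^2 + y^2, z and w are first integrals. *)
Lemma leaf1_velocity s t c u :
    integral_curve M N 1 s t c -> u \in `]s, t[ ->
  [/\ c u 0 0 * derive1 c u 0 0 + c u 0 1 * derive1 c u 0 1 = 0,
      derive1 c u 0 2 = 0 & derive1 c u 0 3 = 0].
Proof.
move=> ic /ic[[Mc sing] _ _ _ eig].
have [C [S [al [be [ga [de [[_ _ CS1] al1 ga1 cE]]]]]]] :=
  ellipsoidP b_gt0 ab Mc.
have [_ s1 _] := foliation_singE b_gt0 ab; rewrite s1 in sing.
have [_ p12 _] := strata_torus b_gt0 ab CS1 al1 ga1.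
have C0 : C != 0 by apply/eqP => /p12; rewrite -cE.
have [eig1 _ _] := eigenline_torus b_gt0 ab CS1 al1 ga1.
move: eig; rewrite cE (eig1 C0) => /sub_rVP[mu ->].
by rewrite !mxE /=; split; ring.
Qed.

(** These equations say that z^2 + w^2, x and y are first integrals. *)
Lemma leaf3_velocity s t c u :
    integral_curve M N 3 s t c -> u \in `]s, t[ ->
  [/\ c u 0 2 * derive1 c u 0 2 + c u 0 3 * derive1 c u 0 3 = 0,
      derive1 c u 0 0 = 0 & derive1 c u 0 1 = 0].
Proof.
move=> ic /ic[[Mc sing] _ _ _ eig].
have [C [S [al [be [ga [de [[_ _ CS1] al1 ga1 cE]]]]]]] :=
  ellipsoidP b_gt0 ab Mc.
have [_ _ s3] := foliation_singE b_gt0 ab; rewrite s3 in sing.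
have [_ _ p23] := strata_torus b_gt0 ab CS1 al1 ga1.
have S0 : S != 0 by apply/eqP => /p23; rewrite -cE.
have [_ _ eig3] := eigenline_torus b_gt0 ab CS1 al1 ga1.
move: eig; rewrite cE (eig3 S0) => /sub_rVP[mu ->].
by rewrite !mxE /=; split; ring.
Qed.

(** The velocity is parallel to the position in both coordinate planes, where
    the position does not vanish off the singular set. *)
Lemma leaf2_velocity s t c u :
    integral_curve M N 2 s t c -> u \in `]s, t[ ->
  [/\ derive1 c u 0 0 * c u 0 1 = derive1 c u 0 1 * c u 0 0,
      derive1 c u 0 2 * c u 0 3 = derive1 c u 0 3 * c u 0 2,
      0 < c u 0 0 ^+ 2 + c u 0 1 ^+ 2 & 0 < c u 0 2 ^+ 2 + c u 0 3 ^+ 2].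
Proof.
have [a_neq0 b_neq0] := axes_neq0 b_gt0 ab.
move=> ic /ic[[Mc sing] _ _ _ eig].
have [C [S [al [be [ga [de [[_ _ CS1] al1 ga1 cE]]]]]]] :=
  ellipsoidP b_gt0 ab Mc.
have [s2 _ _] := foliation_singE b_gt0 ab; rewrite s2 in sing.
have [_ p12 p23] := strata_torus b_gt0 ab CS1 al1 ga1.
have C0 : C != 0 by apply/eqP => /p12; rewrite -cE => ?; apply: sing; left.
have S0 : S != 0 by apply/eqP => /p23; rewrite -cE => ?; apply: sing; right.
have [_ eig2 _] := eigenline_torus b_gt0 ab CS1 al1 ga1.
move: eig; rewrite cE (eig2 C0 S0) => /sub_rVP[mu ->].
rewrite !mxE /= !exprMn -!mulrDr al1 ga1 !mulr1 -!exprMn.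
by split; [ring|ring| |]; rewrite exprn_even_gt0 //= mulf_neq0.
Qed.

Lemma circle_point (r x y : R) : 0 < r -> x ^+ 2 + y ^+ 2 = r ^+ 2 ->
  exists t, x = r * cos t /\ y = r * sin t.
Proof.
move=> r_gt0 xy; have r_neq0 : r != 0 by rewrite gt_eqF.
have [|t [ct st]] := @unit_angle R (x / r) (y / r).
  by rewrite !exprMn !exprVn -mulrDl xy divff // sqrf_eq0.
by exists t; rewrite -ct -st; split; field.
Qed.


(** A circle that is tangent to the i-th eigenline field at each of its points
    is contained in the leaf through any of them: an interval of parameters of
    finite length suffices to join two given points. *)
Lemma circle_leaf i p o e1 e2 r : orthonormal2 e1 e2 -> 0 < r ->
    (forall u, [/\ M (ellipse_point o e1 e2 r r u),
        ~ foliation_sing M N i (ellipse_point o e1 e2 r r u)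
      & (ellipse_point 0 e2 e1 r (- r) u
           <= eigenline N i (ellipse_point o e1 e2 r r u))%MS]) ->
    range (ellipse_point o e1 e2 r r) p ->
    leaf M N i p `<=` range (ellipse_point o e1 e2 r r) ->
  is_circle (leaf M N i p).
Proof.
move=> e12 r_gt0 tan [u _ gu] sub; exists o, e1, e2, r; split=> //.
apply/seteqP; split=> // _ [t _ <-].
(* Any open interval containing both parameters [t] and [u] will do. *)
exists (- (`|t| + `|u| + 1)), (`|t| + `|u| + 1), (ellipse_point o e1 e2 r r).
split.
- move=> v _; have [Mq sing eig] := tan v; split=> //.
  + exact: derivable_ellipse.
  + by rewrite derive1_ellipse; apply: continuous_ellipse.
  + by apply: ellipse_velocity_neq0 => //; rewrite gt_eqF.
  + by rewrite derive1_ellipse.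
- by exists u; rewrite //= in_itv /= -ltr_norml ltr_pwDr // lerDr.
- by exists t; rewrite //= in_itv /= -ltr_norml ltr_pwDr // lerDl.
Qed.

(** First integrals of the eigenline field are constant on leaves. *)
Lemma integral_curve_cst i (f : 'rV[R]_4 -> R) p q :
    (forall s t c u, integral_curve M N i s t c -> u \in `]s, t[ ->
      is_derive u 1 (f \o c) 0) ->
  leaf M N i p q -> f q = f p.
Proof.
move=> df0 [s [t [c [ic [u uI <-] [v vI <-]]]]].
by apply: (@is_derive_0_itv R (f \o c) s t) => // w; apply: df0.
Qed.

Lemma integral_curve_coord i s t c u j : integral_curve M N i s t c ->
    u \in `]s, t[ -> is_derive u 1 (fun v => c v 0 j) (derive1 c u 0 j).
Proof. by move=> ic /ic[_ ? _ _ _]; apply: is_derive_coord. Qed.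

Lemma leaf_ellipsoid i p q : leaf M N i p q -> M q.
Proof. by case=> s [t [c [ic _ [u /ic[[Mq _] _ _ _ _] <-]]]]. Qed.

Lemma leaf1_circle p : M p -> ~ foliation_sing M N 1 p -> is_circle (leaf M N 1 p).
Proof.
have [_ s1 _] := foliation_singE b_gt0 ab; rewrite s1 => Mp sing.
have [C [S [al [be [ga [de [[C_ge0 _ CS1] al1 ga1 pE]]]]]]] :=
  ellipsoidP b_gt0 ab Mp.
have C_neq0 : C != 0.
  have [_ p12 _] := strata_torus b_gt0 ab CS1 al1 ga1.
  by apply/eqP => /p12; rewrite -pE.
have a_gt0 := lt_trans b_gt0 ab.
have r_gt0 : 0 < a * C by rewrite mulr_gt0 // lt_neqAle eq_sym C_neq0.
pose o := vec4 0 0 (b * S * ga) (b * S * de).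
pose g := ellipse_point o (vec4 1 0 0 0) (vec4 0 1 0 0) (a * C) (a * C).
have gE u : g u = torus_pt a b C S (cos u) (sin u) ga de.
  by rewrite /g ellipse4E /torus_pt; congr vec4; ring.
apply: (@circle_leaf 1 p o (vec4 1 0 0 0) (vec4 0 1 0 0) (a * C)) => //.
- by rewrite /orthonormal2 !dot_vec4; split; ring.
- move=> u; rewrite s1 -/(g u) gE; have c1 := cos2Dsin2 u; split.
  + exact: ellipsoid_torus.
  + have [_ p12 _] := strata_torus b_gt0 ab CS1 c1 ga1.
    by move=> /p12 /eqP; rewrite (negPf C_neq0).
  + have [eig1 _ _] := eigenline_torus b_gt0 ab CS1 c1 ga1.
    rewrite (eig1 C_neq0) -vec4_0 ellipse4E; apply/sub_rVP; exists (a * C).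
    by rewrite rowK /= [RHS]row4E !mxE /=; congr vec4; ring.
- have [u [alE beE]] := unit_angle al1.
  by exists u; rewrite //= -/(g u) gE pE alE beE.
- move=> q leafq.
  have q2 : q 0 2 = p 0 2.
    apply: (integral_curve_cst (f := fun x => x 0 2) _ leafq) => s t c u ic uI.
    have [_ dc2 _] := leaf1_velocity ic uI.
    exact: (is_derive_eq (integral_curve_coord 2 ic uI)).
  have q3 : q 0 3 = p 0 3.
    apply: (integral_curve_cst (f := fun x => x 0 3) _ leafq) => s t c u ic uI.
    have [_ _ dc3] := leaf1_velocity ic uI.
    exact: (is_derive_eq (integral_curve_coord 3 ic uI)).
  have q01 : q 0 0 ^+ 2 + q 0 1 ^+ 2 = p 0 0 ^+ 2 + p 0 1 ^+ 2.
    apply: (integral_curve_cst (f := fun x => x 0 0 ^+ 2 + x 0 1 ^+ 2) _ leafq).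
    move=> s t c u ic uI; have [r0 _ _] := leaf1_velocity ic uI.
    apply: (is_derive_eq (is_deriveD
      (is_deriveX 2 (integral_curve_coord 0 ic uI))
      (is_deriveX 2 (integral_curve_coord 1 ic uI)))).
    by rewrite /GRing.scale /= !expr1 -!mulrA -mulrDr r0 mulr0.
  have [|t [q0 q1]] := circle_point r_gt0 (x := q 0 0) (y := q 0 1).
    by rewrite q01 pE !mxE /= !exprMn -mulrDr al1 mulr1.
  exists t => //; rewrite -/(g t) gE [RHS]row4E q0 q1 q2 q3 pE !mxE /=.
  by [].
Qed.

Lemma leaf3_circle p : M p -> ~ foliation_sing M N 3 p -> is_circle (leaf M N 3 p).
Proof.
have [_ _ s3] := foliation_singE b_gt0 ab; rewrite s3 => Mp sing.
have [C [S [al [be [ga [de [[_ S_ge0 CS1] al1 ga1 pE]]]]]]] :=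
  ellipsoidP b_gt0 ab Mp.
have S_neq0 : S != 0.
  have [_ _ p23] := strata_torus b_gt0 ab CS1 al1 ga1.
  by apply/eqP => /p23; rewrite -pE.
have r_gt0 : 0 < b * S by rewrite mulr_gt0 // lt_neqAle eq_sym S_neq0.
pose o := vec4 (a * C * al) (a * C * be) 0 0.
pose g := ellipse_point o (vec4 0 0 1 0) (vec4 0 0 0 1) (b * S) (b * S).
have gE u : g u = torus_pt a b C S al be (cos u) (sin u).
  by rewrite /g ellipse4E /torus_pt; congr vec4; ring.
apply: (@circle_leaf 3 p o (vec4 0 0 1 0) (vec4 0 0 0 1) (b * S)) => //.
- by rewrite /orthonormal2 !dot_vec4; split; ring.
- move=> u; rewrite s3 -/(g u) gE; have c1 := cos2Dsin2 u; split.
  + exact: ellipsoid_torus.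
  + have [_ _ p23] := strata_torus b_gt0 ab CS1 al1 c1.
    by move=> /p23 /eqP; rewrite (negPf S_neq0).
  + have [_ _ eig3] := eigenline_torus b_gt0 ab CS1 al1 c1.
    rewrite (eig3 S_neq0) -vec4_0 ellipse4E; apply/sub_rVP; exists (b * S).
    by rewrite rowK /= [RHS]row4E !mxE /=; congr vec4; ring.
- have [u [gaE deE]] := unit_angle ga1.
  by exists u; rewrite //= -/(g u) gE pE gaE deE.
- move=> q leafq.
  have q0 : q 0 0 = p 0 0.
    apply: (integral_curve_cst (f := fun x => x 0 0) _ leafq) => s t c u ic uI.
    have [_ dc0 _] := leaf3_velocity ic uI.
    exact: (is_derive_eq (integral_curve_coord 0 ic uI)).
  have q1 : q 0 1 = p 0 1.
    apply: (integral_curve_cst (f := fun x => x 0 1) _ leafq) => s t c u ic uI.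
    have [_ _ dc1] := leaf3_velocity ic uI.
    exact: (is_derive_eq (integral_curve_coord 1 ic uI)).
  have q23 : q 0 2 ^+ 2 + q 0 3 ^+ 2 = p 0 2 ^+ 2 + p 0 3 ^+ 2.
    apply: (integral_curve_cst (f := fun x => x 0 2 ^+ 2 + x 0 3 ^+ 2) _ leafq).
    move=> s t c u ic uI; have [r0 _ _] := leaf3_velocity ic uI.
    apply: (is_derive_eq (is_deriveD
      (is_deriveX 2 (integral_curve_coord 2 ic uI))
      (is_deriveX 2 (integral_curve_coord 3 ic uI)))).
    by rewrite /GRing.scale /= !expr1 -!mulrA -mulrDr r0 mulr0.
  have [|t [q2 q3]] := circle_point r_gt0 (x := q 0 2) (y := q 0 3).
    by rewrite q23 pE !mxE /= !exprMn -mulrDr ga1 mulr1.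
  exists t => //; rewrite -/(g t) gE [RHS]row4E q0 q1 q2 q3 pE !mxE /=.
  by [].
Qed.

Lemma unit_angle_quadrant (x y : R) : 0 < x -> 0 < y -> x ^+ 2 + y ^+ 2 = 1 ->
  exists2 t, t \in `]0, pi / 2[ & x = cos t /\ y = sin t.
Proof.
move=> x_gt0 y_gt0 xy1.
have x_lt1 : x < 1.
  by rewrite -(@ltr_pXn2r _ 2) ?nnegrE ?ler01 ?ltW // expr1n -xy1 ltrDl exprn_gt0.
have xI : -1 <= x <= 1 by rewrite (le_trans _ (ltW x_gt0)) ?lerN10 // ltW.
have cx : cos (acos x) = x by rewrite acosK ?in_itv.
exists (acos x).
  rewrite in_itv /= acos_gt0 ?x_lt1 ?(le_trans _ (ltW x_gt0)) ?lerN10 //=.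
  rewrite -ltr_cos ?in_itv /= ?acos_ge0 ?acos_lepi //; first by rewrite cos_pihalf cx.
  by rewrite divr_ge0 ?pi_ge0 //= ler_pdivrMr // ler_peMr ?pi_ge0 // ler1n.
rewrite cx; split=> //; rewrite sin_acos // -xy1 addrAC subrr add0r sqrtr_sqr.
by rewrite gtr0_norm.
Qed.

(** In the (i, j)-plane the velocity is parallel to the position, which does not
    vanish; so the position keeps its direction, and not only its line. *)
Lemma leaf2_direction i j p q :
    (forall s t c u, integral_curve M N 2 s t c -> u \in `]s, t[ ->
      derive1 c u 0 i * c u 0 j = derive1 c u 0 j * c u 0 i /\
      0 < c u 0 i ^+ 2 + c u 0 j ^+ 2) ->
    leaf M N 2 p q ->
  let r (x : 'rV[R]_4) := Num.sqrt (x 0 i ^+ 2 + x 0 j ^+ 2) in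
  [/\ q 0 i = r q * (p 0 i / r p), q 0 j = r q * (p 0 j / r p)
    & 0 < q 0 i ^+ 2 + q 0 j ^+ 2].
Proof.
move=> wedge leafq r.
have r_gt0 : 0 < q 0 i ^+ 2 + q 0 j ^+ 2.
  by case: leafq => s [t [c [ic _ [u /(wedge _ _ _ _ ic)[_ ?] <-]]]].
have rq_neq0 : r q != 0 by rewrite sqrtr_eq0 -ltNge.
split=> //.
- have <- : q 0 i / r q = p 0 i / r p; last by rewrite mulrC divfK.
  apply: (integral_curve_cst (f := fun x => x 0 i / r x) _ leafq).
  move=> s t c u ic uI; have [parallel ru_gt0] := wedge _ _ _ _ ic uI.
  exact: (is_derive_direction (integral_curve_coord i ic uI)
    (integral_curve_coord j ic uI)).
- have <- : q 0 j / r q = p 0 j / r p; last by rewrite mulrC divfK.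
  have rE : r = fun x => Num.sqrt (x 0 j ^+ 2 + x 0 i ^+ 2).
    by apply/funext => x; rewrite /r addrC.
  apply: (integral_curve_cst (f := fun x => x 0 j / r x) _ leafq).
  move=> s t c u ic uI; have [parallel ru_gt0] := wedge _ _ _ _ ic uI.
  rewrite rE; rewrite addrC in ru_gt0.
  exact: (is_derive_direction (integral_curve_coord j ic uI)
    (integral_curve_coord i ic uI)).
Qed.

(** The two directions are constant along the leaf, and the two radii are
    positive and related by the equation of the ellipsoid; so the leaf is
    parametrized by an angle in the open first quadrant. *)
Lemma leaf2_arc p : M p -> ~ foliation_sing M N 2 p ->
  is_ellipse_arc_ending_in (leaf M N 2 p) (P12 M N `|` P23 M N).
Proof.
have [a_neq0 b_neq0] := axes_neq0 b_gt0 ab; have a_gt0 := lt_trans b_gt0 ab.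
have [s2 _ _] := foliation_singE b_gt0 ab; rewrite s2 => Mp sing.
have [C [S [al [be [ga [de [[C_ge0 S_ge0 CS1] al1 ga1 pE]]]]]]] :=
  ellipsoidP b_gt0 ab Mp.
have [_ p12 p23] := strata_torus b_gt0 ab CS1 al1 ga1.
have C_gt0 : 0 < C.
  rewrite lt_neqAle C_ge0 andbT eq_sym; apply/eqP => /p12.
  by rewrite -pE => ?; apply: sing; left.
have S_gt0 : 0 < S.
  rewrite lt_neqAle S_ge0 andbT eq_sym; apply/eqP => /p23.
  by rewrite -pE => ?; apply: sing; right.
pose g := ellipse_point 0 (vec4 al be 0 0) (vec4 0 0 ga de) a b.
have gE u : g u = torus_pt a b (cos u) (sin u) al be ga de.
  by rewrite /g -vec4_0 ellipse4E /torus_pt; congr vec4; ring.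
have e12 : orthonormal2 (vec4 al be 0 0) (vec4 0 0 ga de).
  by rewrite /orthonormal2 !dot_vec4 !(mulr0, mul0r, addr0, add0r) -!expr2.
have g_ic : integral_curve M N 2 0 (pi / 2) g.
  move=> u; rewrite in_itv /= => /andP[u_gt0 u_lt].
  have cs1 := cos2Dsin2 u.
  have cu : cos u != 0.
    rewrite gt_eqF // cos_gt0_pihalf // u_lt andbT (lt_trans _ u_gt0) //.
    by rewrite oppr_lt0 divr_gt0 ?pi_gt0.
  have su : sin u != 0 by rewrite gt_eqF // sin_gt0_pihalf // u_gt0.
  have [_ g12 g23] := strata_torus b_gt0 ab cs1 al1 ga1.
  have regular : M (g u) /\ ~ foliation_sing M N 2 (g u).
    rewrite s2 gE; split; first exact: ellipsoid_torus.
    by case=> [/g12|/g23] /eqP; [rewrite (negPf cu)|rewrite (negPf su)].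
  split=> //.
  - exact: derivable_ellipse.
  - by rewrite derive1_ellipse; apply: continuous_ellipse.
  - exact: ellipse_velocity_neq0.
  - have [_ eig2 _] := eigenline_torus b_gt0 ab cs1 al1 ga1.
    rewrite gE (eig2 cu su) derive1_ellipse -vec4_0 ellipse4E.
    apply/sub_rVP; exists 1; rewrite rowK /= [RHS]row4E !mxE /=.
    by congr vec4; ring.
exists 0, (vec4 al be 0 0), (vec4 0 0 ga de), a, b, 0, (pi / 2); split=> //.
- split; first by rewrite divr_gt0 ?pi_gt0.
  by have := @pi_gt0 R; lra.
- apply/seteqP; split=> q.
  + move=> leafq; have Mq := leaf_ellipsoid leafq.
    have [q0 q1 r_gt0] := leaf2_direction (i := 0) (j := 1)
      (fun _ _ _ _ ic uI =>
        let: And4 w _ r _ := leaf2_velocity ic uI in conj w r) leafq.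
    have [q2 q3 s_gt0] := leaf2_direction (i := 2) (j := 3)
      (fun _ _ _ _ ic uI =>
        let: And4 _ w _ r := leaf2_velocity ic uI in conj w r) leafq.
    move: q0 q1 q2 q3.
    have -> : p 0 0 = a * C * al by rewrite pE mxE.
    have -> : p 0 1 = a * C * be by rewrite pE mxE.
    have -> : p 0 2 = b * S * ga by rewrite pE mxE.
    have -> : p 0 3 = b * S * de by rewrite pE mxE.
    rewrite ![(_ * al) ^+ 2]exprMn ![(_ * be) ^+ 2]exprMn -mulrDr al1 mulr1.
    rewrite ![(_ * ga) ^+ 2]exprMn ![(_ * de) ^+ 2]exprMn -mulrDr ga1 mulr1.
    rewrite !sqrtr_sqr !gtr0_norm ?mulr_gt0 //.
    set r := Num.sqrt _; set s := Num.sqrt _ => q0 q1 q2 q3.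
    have [|||t tI [rt st]] := @unit_angle_quadrant (r / a) (s / b).
    * by rewrite divr_gt0 // sqrtr_gt0.
    * by rewrite divr_gt0 // sqrtr_gt0.
    * rewrite -[RHS]Mq /quadric !exprMn !exprVn !sqr_sqrtr //; exact: ltW.
    exists t => //; rewrite -/(g t) gE /torus_pt -rt -st [RHS]row4E q0 q1 q2 q3.
    have [C_neq0 S_neq0] : C != 0 /\ S != 0 by split; rewrite gt_eqF.
    by congr vec4; field; rewrite ?a_neq0 ?b_neq0 ?C_neq0 ?S_neq0.
  + case=> t tI <-; have [u uI [CE SE]] := unit_angle_quadrant C_gt0 S_gt0 CS1.
    exists 0, (pi / 2), g; split=> //; last by exists t.
    by exists u; rewrite // gE pE CE SE.
- rewrite -/(g _) -/(g _) !gE; split.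
  + right.
    have [_ _ g23] := strata_torus b_gt0 ab (cos2Dsin2 (0 : R)) al1 ga1.
    by apply/g23; rewrite sin0.
  + left.
    have [_ g12 _] := strata_torus b_gt0 ab (cos2Dsin2 (pi / 2 : R)) al1 ga1.
    by apply/g12; rewrite cos_pihalf.
Qed.

End Leaves.

(** * Linking *)

Lemma cos_sin_inj (R : realType) (u v : R) :
    u \in `[0, pi *+ 2[ -> v \in `[0, pi *+ 2[ ->
  cos u = cos v -> sin u = sin v -> u = v.
Proof.
wlog le_uv : u v / u <= v.
  by move=> W uI vI cuv suv; have [/W->|/ltW/W->] := leP u v.
rewrite !in_itv /= => /andP[u_ge0 _] /andP[_ v_lt] cuv suv.
have cd : cos (v - u) = 1 by rewrite cosB cuv suv -!expr2 cos2Dsin2.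
apply/eqP; rewrite eq_le le_uv /=; rewrite leNgt; apply/negP => lt_uv.
have : 0 < sin ((v - u) / 2).
  apply: sin_gt0_pi; rewrite divr_gt0 ?subr_gt0 //= ltr_pdivrMr //.
  by rewrite mulr_natr ltrBlDr ltr_wpDr.
rewrite lt_neqAle eq_sym => /andP[/eqP []].
apply/eqP; rewrite -sqrf_eq0 sin2cos2 subr_eq0 eq_sym.
have half : v - u = (v - u) / 2 *+ 2 by rewrite -mulr_natr divfK.
by move: cd; rewrite half cos_mulr2n -half => cd; apply/eqP; lra.
Qed.

Lemma simple_closed_circle (R : realType) (c e1 e2 : 'rV[R]_4) (r : R) :
    orthonormal2 e1 e2 -> 0 < r ->
  simple_closed_curve (ellipse_point c e1 e2 r r)
    (range (ellipse_point c e1 e2 r r)).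
Proof.
move=> e12 r_gt0; have r_neq0 : r != 0 by rewrite gt_eqF.
split=> //.
- by move=> t; split; [exact: derivable_ellipse|exact: ellipse_velocity_neq0].
- by rewrite derive1_ellipse; apply: continuous_ellipse.
- by move=> t; rewrite /ellipse_point cosD2pi sinD2pi.
- have [e11 e22 e12'] := e12.
  move=> u v uI vI; rewrite /ellipse_point -!addrA => /addrI uv.
  have dotE w t : dot ((r * cos t) *: e1 + (r * sin t) *: e2) w
      = r * cos t * dot e1 w + r * sin t * dot e2 w.
    by rewrite /dot mulmxDl -!scalemxAl !mxE.
  apply: cos_sin_inj => //; apply: (mulfI r_neq0).
    have := congr1 (fun x => dot x e1) uv; rewrite /= !dotE e11.
    have -> : dot e2 e1 = 0 by rewrite dotC.
    by rewrite !mulr0 !mulr1 !addr0.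
  have := congr1 (fun x => dot x e2) uv; rewrite /= !dotE e22 e12'.
  by rewrite !mulr0 !mulr1 !add0r.
Qed.

Lemma det_neq0_inj (F : fieldType) (n : nat) (A : 'M[F]_n) :
  (forall v : 'rV_n, v *m A = 0 -> v = 0) -> \det A != 0.
Proof. by move/inj_row_free; rewrite row_free_unit unitmxE unitfE. Qed.

Section Disc.
Variables (R : realType) (a b : R).
Hypotheses (b_gt0 : 0 < b) (ab : b < a).
Local Notation N := (inner_normal a b).
Local Notation M := (ellipsoid a b).

Definition norm2 (q : 'rV[R]_2) : R := q 0 0 ^+ 2 + q 0 1 ^+ 2.

(** The part of the ellipsoid in the half-space y = 0, x >= 0, as a graph over
    the unit disc.  It is not differentiable on the boundary circle. *)
Definition cap (q : 'rV[R]_2) : 'rV[R]_4 :=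
  vec4 (a * Num.sqrt (1 - norm2 q)) 0 (b * q 0 0) (b * q 0 1).

Lemma cap_ellipsoid q : disc q -> M (cap q).
Proof.
have [a_neq0 b_neq0] := axes_neq0 b_gt0 ab.
rewrite /disc /= -/(norm2 q) => q_le1.
rewrite /M /= /quadric !mxE /= !exprMn sqr_sqrtr ?subr_ge0 // /norm2.
by field; rewrite ?a_neq0 ?b_neq0.
Qed.

Lemma is_diff_norm2 (q : 'rV[R]_2) :
  is_diff q norm2 (fun v => 2 * q 0 0 * v 0 0 + 2 * q 0 1 * v 0 1).
Proof.
exact: (is_diffD (is_diff_sqr (is_diff_coord 0 0 q))
  (is_diff_sqr (is_diff_coord 0 1 q))).
Qed.

Lemma continuous_norm2 : continuous norm2.
Proof. by move=> q; apply: differentiable_continuous; have [] := is_diff_norm2 q. Qed.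

Lemma is_diff_height (q : 'rV[R]_2) : open_disc q ->
  is_diff q (fun x => Num.sqrt (1 - norm2 x))
    (fun v => - (q 0 0 * v 0 0 + q 0 1 * v 0 1) / Num.sqrt (1 - norm2 q)).
Proof.
rewrite /open_disc /= -/(norm2 q) -subr_gt0 => q_lt1.
have s_neq0 : Num.sqrt (1 - norm2 q) != 0 by rewrite sqrtr_eq0 -ltNge.
have h := is_diffB (is_diff_cst (1 : R) q) (is_diff_norm2 q).
apply: (is_diff_eq (is_diff_comp_real h (is_derive1_sqrt q_lt1))).
by apply/funext => v; rewrite sub0r !fctE /=; field.
Qed.

Lemma is_diff_cap (q : 'rV[R]_2) : open_disc q ->
  is_diff q cap (fun v => vec4
    (a * (- (q 0 0 * v 0 0 + q 0 1 * v 0 1) / Num.sqrt (1 - norm2 q))) 0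
    (b * v 0 0) (b * v 0 1)).
Proof.
move=> qD; apply: is_diff_vec4.
- exact: (is_diffZ a (is_diff_height qD)).
- exact: (is_diffZ b (is_diff_coord 0 0 q)).
- exact: (is_diffZ b (is_diff_coord 0 1 q)).
Qed.

Lemma continuous_cap : continuous cap.
Proof.
move=> q.
have -> : cap = (fun x => (a * Num.sqrt (1 - norm2 x)) *: delta_mx 0 0)
  + (fun x => (b * x 0 0) *: delta_mx 0 2) + (fun x => (b * x 0 1) *: delta_mx 0 3).
  by apply/funext => x; rewrite /cap vec4E scale0r addr0.
have lin (f : 'rV[R]_2 -> R) (w : 'rV[R]_4) (c : R) : {for q, continuous f} ->
    {for q, continuous (fun x => (c * f x) *: w)}.
  by move=> fq; apply: (cvgZr_tmp (cvgMl_tmp fq)).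
apply: continuousD; first apply: continuousD.
- apply: (lin (fun x => Num.sqrt (1 - norm2 x))).
  apply: (@continuous_comp _ _ _ (fun x => 1 - norm2 x) Num.sqrt);
    last exact: sqrt_continuous.
  apply: continuousB; [exact: cst_continuous|exact: continuous_norm2].
- by apply: (lin (fun x : 'rV[R]_2 => x 0 0)); apply: coord_continuous.
- by apply: (lin (fun x : 'rV[R]_2 => x 0 1)); apply: coord_continuous.
Qed.

Lemma open_disc_nbhs (q : 'rV[R]_2) : open_disc q -> \forall x \near q, open_disc x.
Proof.
have norm2_cvg : norm2 x @[x --> q] --> norm2 q := @continuous_norm2 q.
by move=> qD; apply: filterS (cvgr_lt (norm2 q) norm2_cvg 1 qD).
Qed.

(** On the open disc the jacobian is given by a formula that is itself
    differentiable. *)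
Lemma continuous_jacobian_cap (q : 'rV[R]_2) : open_disc q ->
  {for q, continuous (jacobian cap)}.
Proof.
move=> qD.
pose s (x : 'rV[R]_2) := (Num.sqrt (1 - norm2 x))^-1.
pose J (x : 'rV[R]_2) : 'M[R]_(2, 4) := (x 0 0 * s x) *: (- a *: delta_mx 0 0)
  + (x 0 1 * s x) *: (- a *: delta_mx 1 0) + (b *: delta_mx 0 2 + b *: delta_mx 1 3).
have JE x : open_disc x -> jacobian cap x = J x.
  move=> xD; apply/row_matrixP => i; rewrite !rowE (is_diff_jacobian _ (is_diff_cap xD)).
  rewrite -[delta_mx 0 i *m J x]rowE [RHS]row4E.
  by case: i => -[|[|//]] i; rewrite !mxE /=; congr vec4; rewrite /s; ring.
have Jq : {for q, continuous J}.
  have s_neq0 : Num.sqrt (1 - norm2 q) != 0.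
    by rewrite sqrtr_eq0 -ltNge subr_gt0.
  have sd : differentiable s q.
    by apply: differentiableV => //; have [] := is_diff_height qD.
  have xd i : differentiable (fun x : 'rV[R]_2 => x 0 i) q by apply: differentiable_coord.
  apply: differentiable_continuous; apply: differentiableD; first apply: differentiableD.
  - by apply: differentiableZl; apply: differentiableM.
  - by apply: differentiableZl; apply: differentiableM.
  - exact: differentiable_cst.
change (jacobian cap x @[x --> q] --> jacobian cap q); rewrite (JE _ qD).
have near_eq : \forall x \near q, J x = jacobian cap x.
  by apply: filterS (open_disc_nbhs qD) => x /JE.
exact: cvg_trans (near_eq_cvg near_eq) Jq.
Qed.

Definition circle12 : R -> 'rV[R]_4 :=
  ellipse_point 0 (vec4 0 0 1 0) (vec4 0 0 0 1) b b.

Definition circle23 : R -> 'rV[R]_4 :=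
  ellipse_point 0 (vec4 1 0 0 0) (vec4 0 1 0 0) a a.

Lemma cap_spanning : spanning_disc M circle12 cap.
Proof.
split.
- exact: cap_ellipsoid.
- by apply: continuous_subspaceT => q; apply: continuous_cap.
- move=> q qD; split; first by have [] := is_diff_cap qD.
  exact: continuous_jacobian_cap.
- move=> u; rewrite /cap /norm2 !mxE /= cos2Dsin2 subrr sqrtr0.
  by rewrite /circle12 -vec4_0 ellipse4E; congr vec4; ring.
Qed.

Lemma crossings_cap : crossings cap circle23 = [set (0, 0)].
Proof.
have [a_neq0 b_neq0] := axes_neq0 b_gt0 ab.
have cE t : circle23 t = vec4 (a * cos t) (a * sin t) 0 0.
  by rewrite /circle23 -vec4_0 ellipse4E; congr vec4; ring.
apply/seteqP; split=> [[q t] [/= _ tI]|_ ->].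
- rewrite cE => /rowP eq_qt; have := (eq_qt 0, eq_qt 1, eq_qt 2, eq_qt 3).
  rewrite !mxE /= => -[[[q0 q1] q2] q3].
  have qE : q = 0.
    apply/rowP => i; rewrite mxE; case: i => -[|[|//]] i; apply: (mulfI b_neq0).
      by rewrite mulr0 -q2; congr (_ * q _ _); apply/val_inj.
    by rewrite mulr0 -q3; congr (_ * q _ _); apply/val_inj.
  rewrite qE; congr (_, _); apply: cos_sin_inj => //.
  + by rewrite in_itv /= lexx mulrn_wgt0 ?pi_gt0.
  + rewrite cos0; apply: (mulfI a_neq0); rewrite -q0 qE /norm2 !mxE.
    by rewrite expr0n addr0 subr0 sqrtr1.
  + by rewrite sin0; apply: (mulfI a_neq0); rewrite -q1 mulr0.
- split=> /=.
  + by rewrite /disc /= !mxE expr0n addr0 ler01.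
  + by rewrite in_itv /= lexx mulrn_wgt0 ?pi_gt0.
  + rewrite cE /cap /norm2 !mxE cos0 sin0 expr0n addr0 subr0 sqrtr1.
    by rewrite !mulr0.
Qed.

(** At the centre of the disc its two partial derivatives are along the z and w
    axes, the velocity of the circle is along the y axis and the normal along
    the x axis. *)
Lemma crossing_det_cap : crossing_det N cap circle23 (0, 0) != 0.
Proof.
have [a_neq0 b_neq0] := axes_neq0 b_gt0 ab.
have p0 : cap 0 = torus_pt a b 1 0 1 0 1 0.
  by rewrite /cap /torus_pt /norm2 !mxE expr0n addr0 subr0 sqrtr1 !(mulr0, mulr1).
have c1 : 1 ^+ 2 + 0 ^+ 2 = 1 :> R by rewrite expr1n expr0n addr0.
have h_gt0 : 0 < gradnorm2 a b (cap 0) by rewrite p0 gradnorm2_gt0.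
have NE : N (cap 0) =
    vec4 (- ((Num.sqrt (gradnorm2 a b (cap 0)))^-1 * (2 / a))) 0 0 0.
  rewrite /inner_normal enorm_grad // grad_quadric // [LHS]row4E p0 !mxE /=.
  by congr vec4; [congr (- (_ * _)); field| | |]; rewrite ?a_neq0 ?b_neq0 //; ring.
have D0 : open_disc (0 : 'rV[R]_2) by rewrite /open_disc /= !mxE expr0n addr0.
apply: (@det_neq0_inj _ (2 + (1 + 1))) => v.
rewrite /= derive1_ellipse NE -vec4_0 ellipse4E cos0 sin0.
rewrite -[v](@hsubmxK _ 1 2 (1 + 1)) -[rsubmx v](@hsubmxK _ 1 1 1).
move: (lsubmx v) (lsubmx (rsubmx v)) (rsubmx (rsubmx v)) => v1 v2 v3.
rewrite !mul_row_col (is_diff_jacobian _ (is_diff_cap D0)).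
rewrite [v2]mx11_scalar [v3]mx11_scalar !mul_scalar_mx.
move: (v2 0 0) (v3 0 0) => x y /rowP v0.
have := (v0 0, v0 1, v0 2, v0 3); rewrite !mxE /= => -[[[e0 e1] e2] e3].
have h_neq0 : Num.sqrt (gradnorm2 a b (cap 0)) != 0 by rewrite sqrtr_eq0 -ltNge.
have xE : x = 0 by apply: (mulIf a_neq0); rewrite mul0r -[RHS]e1; ring.
have yE : y = 0.
  have k_neq0 : - ((Num.sqrt (gradnorm2 a b (cap 0)))^-1 * (2 / a)) != 0.
    by rewrite oppr_eq0 !mulf_neq0 ?invr_eq0 // pnatr_eq0.
  by apply: (mulIf k_neq0); rewrite mul0r -[RHS]e0; ring.
have v10 : v1 0 0 = 0.
  by apply: (mulfI b_neq0); rewrite mulr0 -[RHS]e2 xE; ring.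
have v11 : v1 0 1 = 0.
  by apply: (mulfI b_neq0); rewrite mulr0 -[RHS]e3 xE; ring.
have v1E : v1 = 0.
  apply/rowP => i; rewrite mxE; case: i => -[|[|//]] i;
    [rewrite -[RHS]v10|rewrite -[RHS]v11]; by congr (v1 _ _); apply/val_inj.
rewrite v1E xE yE (_ : 0%:M = 0); last by apply/matrixP => i j; rewrite !mxE mul0rn.
by rewrite !row_mx0 vec4_0.
Qed.

Lemma linked_circles : linked M N (P12 M N) (P23 M N).
Proof.
have a_gt0 := lt_trans b_gt0 ab.
have c12 : P12 M N = range circle12.
  rewrite P12_circle //; congr (_ @` _); apply/funext => v.
  by rewrite /circle12 -vec4_0 ellipse4E; congr vec4; ring.
have c23 : P23 M N = range circle23.
  rewrite P23_circle //; congr (_ @` _); apply/funext => v.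
  by rewrite /circle23 -vec4_0 ellipse4E; congr vec4; ring.
split; [by move=> p []|by move=> p []| |].
  by apply/seteqP; split=> // p [[_ k12 _] [_]]; rewrite k12 ltxx.
exists circle12, circle23, (sgz (crossing_det N cap circle23 (0, 0))); split.
- rewrite c12; apply: simple_closed_circle => //.
  by rewrite /orthonormal2 !dot_vec4; split; ring.
- rewrite c23; apply: simple_closed_circle => //.
  by rewrite /orthonormal2 !dot_vec4; split; ring.
- exists cap; split; first exact: cap_spanning.
  + by rewrite crossings_cap; apply: finite_set1.
  + by rewrite crossings_cap => _ ->; apply: crossing_det_cap.
  + by rewrite crossings_cap fsbig_set1.
- by rewrite sgz_eq0 crossing_det_cap.
Qed.

End Disc.

(** * The theorem *)

Unset Implicit Arguments.

Theorem proposition2 (R : realType) (a b : R) (hb : 0 < b) (hab : b < a) :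
  let M := ellipsoid a b in
  let N := inner_normal a b in
  let C23 := range (fun u : R => vec4 (a * cos u) (a * sin u) 0 0) in
  let C12 := range (fun v : R => vec4 0 0 (b * cos v) (b * sin v)) in
  (* (i) *)
  [/\ umbilic M N = set0,
      partially_umbilic M N = C12 `|` C23,
      P12 M N = C12,
      P23 M N = C23
    & linked M N (P12 M N) (P23 M N)] /\
  (* (ii) *)
  [/\ foliation_sing M N 2 = C12 `|` C23,
      foliation_sing M N 1 = C12
    & foliation_sing M N 3 = C23] /\
  (* (iii) *)
  [/\ forall p, M p -> ~ foliation_sing M N 1 p -> is_circle (leaf M N 1 p),
      forall p, M p -> ~ foliation_sing M N 3 p -> is_circle (leaf M N 3 p)
    & forall p, M p -> ~ foliation_sing M N 2 p ->
        is_ellipse_arc_ending_in (leaf M N 2 p) (C12 `|` C23)].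
Proof.
have [s2 s1 s3] := foliation_singE hb hab.
have p12 := P12_circle hb hab; have p23 := P23_circle hb hab.
split; last split.
- split=> //; first exact: umbilic_empty.
  + by rewrite /partially_umbilic p12 p23.
  + exact: linked_circles.
- by rewrite s1 s2 s3 p12 p23.
- split=> p; [exact: leaf1_circle|exact: leaf3_circle|].
  by rewrite -p12 -p23; apply: leaf2_arc.
Qed.
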